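(* Let $0<p<\infty$. If $\varphi:\mathbb{D}\to\mathbb{D}$ is an inner function, then the composition operator $C_{\varphi}:H^{p}\to H^{p}$, $C_\varphi(f)=f\circ\varphi$, has closed range.
   Context: $\mathbb{D}$ is the open unit disc in the complex plane, $\mathbb{T}$ the unit circle, and $m$ the normalized length Lebesgue measure on $\mathbb{T}$. For $0<p<\infty$, $H^p$ is the Hardy space of analytic functions $f$ on $\mathbb{D}$ with $\|f\|_{H^p}^p=\sup_{0\le r<1}\int_{\mathbb{T}}|f(r\zeta)|^p\,dm(\zeta)<\infty$ (for $p<1$ closedness refers to the topology induced by the metric $\|f-g\|_{H^p}^p$). An analytic function $\varphi:\mathbb{D}\to\mathbb{D}$ is inner if its radial limits $\varphi(\zeta)=\lim_{r\to1^-}\varphi(r\zeta)$ satisfy $|\varphi(\zeta)|=1$ for $m$-almost every $\zeta\in\mathbb{T}$. *)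

(* Defs.v *)
From HB Require Import structures.
From mathcomp Require Import all_boot all_order all_algebra.
From mathcomp Require Import all_classical all_reals all_analysis.
From mathcomp Require Import measurable_realfun.
From mathcomp Require Export complex.

Set Implicit Arguments.
Unset Strict Implicit.
Unset Printing Implicit Defensive.

Import Order.TTheory GRing.Theory Num.Theory.
Import numFieldNormedType.Exports.
Import ComplexField.Normc.

Local Open Scope classical_set_scope.
Local Open Scope ring_scope.
Local Open Scope complex_scope.

(* [normc z : R] is the real-valued modulus of [z : R[i]].  The topology of
   R[i] is that of [R[i]^o], the normed module R[i] over itself; [derivable]
   between such spaces in the direction 1 is complex differentiability. *)

Section disc.
Variable R : realType.

Definition disc : set R[i] := [set z | normc z < 1].

Definition circle_pt (t : R) : R[i] := cos t +i* sin t.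

Definition analytic_on_disc (f : R[i] -> R[i]) : Prop :=
  forall z, disc z -> derivable (f : R[i]^o -> R[i]^o) z 1.

(* The integral of |f(r zeta)|^p against the normalized length measure on the
   circle, parametrized by zeta = e^(it) with 0 <= t <= 2 pi. *)
Definition circle_mean (p : R) (f : R[i] -> R[i]) (r : R) : \bar R :=
  (((2 * pi)^-1)%:E * \int[lebesgue_measure]_(t in `[0%R, (2 * pi)%R])
     (normc (f (r%:C * circle_pt t)) `^ p)%:E)%E.

(* The p-th power of the H^p (quasi-)norm, possibly +oo. *)
Definition hardy_normp (p : R) (f : R[i] -> R[i]) : \bar R :=
  ereal_sup [set circle_mean p f r | r in `[0%R, 1%R[].

Definition inner_function (phi : R[i] -> R[i]) : Prop :=
  [/\ analytic_on_disc phi,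
      forall z, disc z -> disc (phi z) &
      {ae @lebesgue_measure R, forall t, t \in `[0, 2 * pi] ->
        exists2 w : R[i]^o,
          (phi (r%:C * circle_pt t) : R[i]^o) @[r --> (1 : R)^'-] --> w &
          normc w = 1}].

End disc.

(* A function on the disc is represented by its extension by 0 to R[i], so that
   equality in [hardy p] is equality on the disc. *)
Record hardy (R : realType) (p : {posnum R}) := Hardy {
  hardy_fun :> R[i] -> R[i];
  hardy_analytic : analytic_on_disc hardy_fun;
  hardy_supp : forall z, ~ disc z -> hardy_fun z = 0;
  hardy_fin : (hardy_normp p%:num hardy_fun < +oo)%E }.

HB.instance Definition _ (R : realType) (p : {posnum R}) :=
  gen_eqMixin (hardy p).
HB.instance Definition _ (R : realType) (p : {posnum R}) :=
  gen_choiceMixin (hardy p).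

Section hardy_topology.
Variable R : realType.
Implicit Types (p : {posnum R}) (f g h : R[i] -> R[i]).

Lemma normc_le_ReIm (z : R[i]) : normc z <= `|complex.Re z| + `|complex.Im z|.
Proof.
have -> : z = (complex.Re z)%:C + 'i * (complex.Im z)%:C.
  by case: z => a b; simpc.
apply: le_trans (le_normcD _ _) _; rewrite normcM /=.
rewrite !expr0n /= !addr0 add0r expr1n sqrtr1 mul1r.
by rewrite !sqrtr_sqr; simpc; rewrite /= ?mul0r ?mul1r ?addr0 ?add0r ?subr0.
Qed.

Lemma circle_pt_continuous (r : R) :
  continuous (fun t : R => (r%:C * circle_pt t : R[i]^o)).
Proof.
move=> t; apply/cvgrPdist_lt => e.
case: e => e e'; rewrite ltcE /= => /andP[/eqP -> e0].
have e20 : 0 < e / 2 by rewrite divr_gt0.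
have cc : (fun s => r * cos s) @ t --> r * cos t.
  by apply: cvgM; [exact: cvg_cst|exact: continuous_cos].
have cs : (fun s => r * sin s) @ t --> r * sin t.
  by apply: cvgM; [exact: cvg_cst|exact: continuous_sin].
move/cvgrPdist_lt : cc => /(_ _ e20) cc.
move/cvgrPdist_lt : cs => /(_ _ e20) cs.
near=> s.
have -> : r%:C * circle_pt t - r%:C * circle_pt s =
    (r * cos t - r * cos s) +i* (r * sin t - r * sin s).
  by rewrite /circle_pt; simpc.
rewrite -[X in X < _]/((normc _)%:C) ltcR.
rewrite (splitr e); apply: le_lt_trans (normc_le_ReIm _) _ => /=.
by rewrite ltrD //; near: s.
Unshelve. all: by end_near. Qed.

Lemma normc_continuous : continuous (fun z : R[i]^o => normc z : R).
Proof.
move=> z; have FF : Filter (nbhs (z : R[i]^o)) by exact: nbhs_filter.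
apply/(@cvgrPdist_lt _ _ _ _ FF) => e e0.
have e0' : 0 < e%:C :> R[i] by rewrite ltcR.
apply/nbhs_ballP; exists e%:C => //= w.
rewrite /ball /= -[X in X < _ -> _]/((normc _)%:C) ltcR.
apply: le_lt_trans.
have H (a b : R[i]) : normc a - normc b <= normc (a - b).
  by rewrite lerBlDr -{1}(subrK b a) le_normcD.
by rewrite ler_norml H lerNl opprB -[normc (z - w)]normcN opprB H.
Qed.

Lemma expi_r_disc (r t : R) : r \in `[0, 1[ -> disc (r%:C * circle_pt t).
Proof.
rewrite in_itv /= => /andP[r0 r1].
rewrite /disc /mkset normcM /= expr0n /= addr0 sqrtr_sqr ger0_norm //.
by rewrite cos2Dsin2 sqrtr1 mulr1.
Qed.

Lemma circle_mean_measurable (p : R) (f : R[i] -> R[i]) (r : R) :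
  analytic_on_disc f -> r \in `[0, 1[ ->
  measurable_fun setT (fun t : R => normc (f (r%:C * circle_pt t)) `^ p).
Proof.
move=> af r01.
have mn : measurable_fun setT (fun t : R => normc (f (r%:C * circle_pt t)) : R);
  last exact: (measurableT_comp (measurable_powR p) mn).
apply: continuous_measurable_fun => t.
apply: (@continuous_comp _ (R[i]^o) _ (fun t => f (r%:C * circle_pt t))
  (fun z => normc z)); last exact: normc_continuous.
apply: (@continuous_comp _ (R[i]^o) (R[i]^o) (fun t => r%:C * circle_pt t) f).
  exact: circle_pt_continuous.
apply: differentiable_continuous; apply/derivable1_diffP.
exact/af/expi_r_disc.
Qed.

Lemma powR_normcD (p : R) (a b : R[i]) : 0 < p ->
  normc (a + b) `^ p <= 2 `^ p * (normc a `^ p + normc b `^ p).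
Proof.
move=> p0.
have n0 (z : R[i]) : 0 <= normc z by case: z => x y; exact: sqrtr_ge0.
wlog ab : a b / normc a <= normc b.
  move=> H; have [|/ltW] := leP (normc a) (normc b); first exact: H.
  by rewrite addrC [X in _ * X]addrC; exact: H.
apply: (@le_trans _ _ ((2 * normc b) `^ p)).
  apply: ge0_ler_powR; rewrite ?nnegrE ?mulr_ge0 ?n0 ?(ltW p0) //.
  by apply: le_trans (le_normcD _ _) _; rewrite mulr_natl mulr2n lerD2r.
rewrite powRM ?n0 //.
by rewrite ler_pM2l ?powR_gt0 // lerDr powR_ge0.
Qed.

Lemma analyticB (f g : R[i] -> R[i]) : analytic_on_disc f ->
  analytic_on_disc g -> analytic_on_disc (fun z => f z - g z).
Proof. by move=> af ag z dz; apply: derivableB; [exact: af|exact: ag]. Qed.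

Lemma circle_meanD (p : R) (f g h : R[i] -> R[i]) (r : R) : 0 < p ->
  analytic_on_disc f -> analytic_on_disc g -> r \in `[0, 1[ ->
  (forall z, h z = f z + g z) ->
  (circle_mean p h r <=
   (2 `^ p)%:E * (circle_mean p f r + circle_mean p g r))%E.
Proof.
move=> p0 af ag r01 hE; rewrite /circle_mean.
set D : set R := [set` `[0%R, (2 * pi)%R]].
have mD : measurable D by exact: measurable_itv.
have pi0 : (0 <= ((2 * pi)^-1 : R)%:E)%E.
  by rewrite lee_fin invr_ge0 mulr_ge0 // pi_ge0.
have mf := measurable_funS measurableT (@subsetT _ D)
  (circle_mean_measurable p af r01).
have mg := measurable_funS measurableT (@subsetT _ D)
  (circle_mean_measurable p ag r01).
have ah : analytic_on_disc h.
  have -> : h = (fun z => f z + g z) by apply/funext => z; exact: hE.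
  by move=> z dz; apply: derivableD; [exact: af|exact: ag].
have mh := measurable_funS measurableT (@subsetT _ D)
  (circle_mean_measurable p ah r01).
set F := fun t : R => normc (f (r%:C * circle_pt t)) `^ p.
set G := fun t : R => normc (g (r%:C * circle_pt t)) `^ p.
have F0 t : (0 <= (F t)%:E)%E by rewrite lee_fin powR_ge0.
have G0 t : (0 <= (G t)%:E)%E by rewrite lee_fin powR_ge0.
rewrite -ge0_muleDr; last 2 first.
- by apply: integral_ge0 => t _; exact: F0.
- by apply: integral_ge0 => t _; exact: G0.
rewrite muleCA; apply: lee_wpmul2l => //.
have mF : measurable_fun D (EFin \o F) by exact/measurable_EFinP.
have mG : measurable_fun D (EFin \o G) by exact/measurable_EFinP.
have mFG : measurable_fun D (fun t => (F t)%:E + (G t)%:E)%E.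
  by apply/measurable_EFinP; apply: measurable_funD; apply/measurable_EFinP.
rewrite -ge0_integralD //; last 2 first.
- by move=> t _; exact: F0.
- by move=> t _; exact: G0.
rewrite -ge0_integralZl //; last by move=> t _; rewrite adde_ge0 ?F0 ?G0.
apply: ge0_le_integral => //.
- by move=> t _; rewrite lee_fin powR_ge0.
- exact/measurable_EFinP.
- by apply: measurable_funeM; exact: mFG.
- move=> t _; rewrite -EFinD -EFinM lee_fin hE; exact: powR_normcD.
Qed.

Lemma hardy_normpD (p : R) (f g h : R[i] -> R[i]) : 0 < p ->
  analytic_on_disc f -> analytic_on_disc g -> (forall z, h z = f z + g z) ->
  (hardy_normp p h <= (2 `^ p)%:E * (hardy_normp p f + hardy_normp p g))%E.
Proof.
move=> p0 af ag hE; apply: ge_ereal_sup => _ [r r01 <-].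
apply: le_trans (circle_meanD p0 af ag r01 hE) _.
apply: lee_wpmul2l; first by rewrite lee_fin powR_ge0.
by apply: leeD; apply: ereal_sup_ubound; exists r.
Qed.

Lemma hardy_normp0 (p : R) : 0 < p -> hardy_normp p (fun=> 0 : R[i]) = 0%E.
Proof.
move=> p0.
have c0 r : circle_mean p (fun=> 0 : R[i]) r = 0%E.
  by rewrite /circle_mean normc0 powR0 ?gt_eqF// integral0_eq ?mule0.
apply/eqP; rewrite eq_le; apply/andP; split.
  by apply: ge_ereal_sup => _ [r _ <-]; rewrite c0.
by apply: ereal_sup_ubound; exists 0; rewrite ?c0 //= in_itv /= lexx ltr01.
Qed.

Lemma hardy_normpN (p : R) (f g : R[i] -> R[i]) :
  (forall z, g z = - f z) -> hardy_normp p g = hardy_normp p f.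
Proof.
move=> gE; congr ereal_sup; apply: eq_imagel => r _.
rewrite /circle_mean; congr (_ * _)%E; apply: eq_integral => t _.
by rewrite gE normcN.
Qed.

End hardy_topology.

Definition hardy_ball (R : realType) (p : {posnum R}) (e : R) :=
  [set fg : hardy p * hardy p |
    (hardy_normp p%:num (fun z => fg.1 z - fg.2 z)%R < e%:E)%E].

(* The topology of H^p: basic neighbourhoods of f are {g | ||f - g||^p < e}.
   For p < 1 these are the balls of the metric ||f - g||^p; for p >= 1 they are
   the norm balls of radius e^(1/p). *)
Definition hardy_entourage (R : realType) (p : {posnum R}) :
    set_system (hardy p * hardy p) :=
  filter_from [set e : R | 0 < e] (hardy_ball (p := p)).

Section hardy_uniform.
Variables (R : realType) (p : {posnum R}).
Local Notation E := (hardy_entourage (p := p)).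

Lemma hardy_entourage_filter : Filter E.
Proof.
apply: filter_from_filter; first by exists 1 => /=; exact: ltr01.
move=> i j /= i0 j0; exists (Num.min i j) => /=; first by rewrite lt_min i0.
move=> fg; rewrite /hardy_ball /= => H.
by split; apply: (lt_le_trans H); rewrite lee_fin ge_min lexx ?orbT.
Qed.

Lemma hardy_entourage_diagonal A : E A -> diagonal `<=` A.
Proof.
move=> [e /= e0 eA] [g f]; rewrite /diagonal /= => ->; apply: eA; rewrite /hardy_ball /=.
have -> : (fun z => f z - f z) = (fun=> 0) by apply/funext => z; rewrite subrr.
by rewrite hardy_normp0 // lte_fin.
Qed.

Lemma hardy_entourage_inv A : E A -> E (A^-1)%relation.
Proof.
move=> [e /= e0 eA]; exists e => // -[f g] H; apply: eA; move: H.
rewrite /hardy_ball /=; apply: le_lt_trans; rewrite le_eqVlt; apply/orP; left.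
by apply/eqP; apply: hardy_normpN => z; rewrite opprB.
Qed.

Lemma hardy_entourage_split A : E A -> exists2 B, E B & (B \; B)%relation `<=` A.
Proof.
move=> [e /= e0 eA].
have c0 : 0 < 2 `^ p%:num :> R by rewrite powR_gt0.
pose d := e / (2 `^ p%:num) / 2.
have d0 : 0 < d by rewrite !divr_gt0.
exists (hardy_ball (p := p) d); first by exists d.
move=> [f g] [h /= Hfh Hhg]; apply: eA; rewrite /hardy_ball /=.
apply: le_lt_trans.
  apply: (@hardy_normpD R p%:num (fun z => f z - h z) (fun z => h z - g z)) => //.
  - by apply: analyticB; exact: hardy_analytic.
  - by apply: analyticB; exact: hardy_analytic.
  - by move=> z; rewrite addrA subrK.
have -> : e%:E = ((2 `^ p%:num)%:E * (d%:E + d%:E))%E.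
  by rewrite -EFinD -EFinM -splitr mulrC divfK // gt_eqF.
by rewrite lte_pmul2l // lteD.
Qed.

End hardy_uniform.

HB.instance Definition _ (R : realType) (p : {posnum R}) :=
  isUniform.Build (hardy p) (hardy_entourage_filter p)
    (@hardy_entourage_diagonal R p) (@hardy_entourage_inv R p)
    (@hardy_entourage_split R p).

(* Main.v *)
Require Import Defs.
From HB Require Import structures.
From mathcomp Require Import all_boot all_order all_algebra.
From mathcomp Require Import all_classical all_reals all_analysis.
From mathcomp Require Import complex.
From mathcomp Require Import measurable_realfun ring lra.

(* Let [u = |f|^p] and let [P_s u] be the Poisson integral of [u] on the circle of
   radius [s].  As [u] is subharmonic, [u <= P_s u] inside this circle, and gluing
   [P_s u] inside with [u] outside gives a subharmonic majorant [u_s] of [u].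
   The function [u_s o phi] is again subharmonic, so
     [P_s u (phi 0) = u_s (phi 0) <= mean of u_s o phi on |z| = r].
   Since [phi] is inner, [u_s o phi - u o phi], which vanishes where
   [|phi| >= s], tends to 0 boundedly almost everywhere as [r -> 1]; hence
   [P_s u (phi 0) <= ||f o phi||^p] and, the Poisson kernel at [phi 0] being bounded
   below, [||f||^p <= C ||f o phi||^p] with [C] independent of [f].  If
   [f_n o phi -> g] in H^p then [f_n] is Cauchy, so it converges locally uniformly
   to some [f] in H^p, and [g = f o phi].  The domination [u <= P_s u], composed
   with [phi], also shows that composition maps H^p to itself (Littlewood).

   Cauchy's theorem is obtained from Goursat's bisection argument in logarithmic
   coordinates, in the form of the mean value property on circles. *)

Set Implicit Arguments.
Unset Strict Implicit.
Unset Printing Implicit Defensive.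

Import Order.TTheory GRing.Theory Num.Theory.
Import numFieldNormedType.Exports.
Import ComplexField.Normc.

Local Open Scope classical_set_scope.
Local Open Scope ring_scope.
Local Open Scope complex_scope.

(** * Moduli and complex derivatives *)

Section complex_basics.
Variable R : realType.
Implicit Types (x y z w : R[i]) (f : R[i] -> R[i]) (v : R[i] -> R).
Local Notation Re := (@complex.Re R).
Local Notation Im := (@complex.Im R).

(** On the boundary the result is a change of variables: an inner function carries length measure to
    harmonic measure at [phi 0]. That route needs boundary functions of [f] and of [f o phi] for
    every exponent. Passing to [u_s] avoids them: of the boundary behaviour of [phi], all that is
    used is that along almost every radius [|phi|] eventually exceeds [s]. Although [f] may be
    unbounded, [u_s - u] is bounded, because it vanishes outside the disc of radius [s]; so a
    constant dominates it. The estimate bounds one circle mean of [f], of radius [s > |phi 0|], and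
    its constant stays bounded as [s] tends to 1. Every integral is therefore that of a continuous
    function over a circle inside the disc. The bound [u <= P_s u] comes from [log |f|] and Jensen's
    inequality for the exponential, and the triangle inequality carries a factor [2^p], harmless for
    Cauchy sequences. *)

Lemma cReD x y : Re (x + y) = Re x + Re y. Proof. by case: x; case: y. Qed.
Lemma cImD x y : Im (x + y) = Im x + Im y. Proof. by case: x; case: y. Qed.
Lemma cReN x : Re (- x) = - Re x. Proof. by case: x. Qed.
Lemma cImN x : Im (- x) = - Im x. Proof. by case: x. Qed.
Lemma cReM x y : Re (x * y) = Re x * Re y - Im x * Im y.
Proof. by case: x; case: y. Qed.
Lemma cImM x y : Im (x * y) = Re x * Im y + Im x * Re y.
Proof. by case: x; case: y. Qed.
Definition ReImE := (cReD, cImD, cReN, cImN, cReM, cImM).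

Lemma ReIm_eq x y : Re x = Re y -> Im x = Im y -> x = y.
Proof. by case: x => a b; case: y => c d /= -> ->. Qed.

Lemma normc_ge0 x : 0 <= normc x.
Proof. by case: x => a b; exact: sqrtr_ge0. Qed.

Lemma normc_sqr x : normc x ^+ 2 = Re x ^+ 2 + Im x ^+ 2.
Proof. by case: x => a b; rewrite sqr_sqrtr //= addr_ge0 ?sqr_ge0. Qed.

Lemma normc_eq0 x : (normc x == 0) = (x == 0).
Proof.
by apply/eqP/eqP => [/eq0_normc //|->]; rewrite normc0.
Qed.

Lemma normc_gt0 x : (0 < normc x) = (x != 0).
Proof. by rewrite lt_neqAle eq_sym normc_eq0 normc_ge0 andbT. Qed.

Lemma normcR (r : R) : normc r%:C = `|r|.
Proof. by rewrite /= expr0n addr0 sqrtr_sqr. Qed.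

Lemma normRe x : `|Re x| <= normc x.
Proof.
by rewrite -(@ler_pXn2r _ 2) ?nnegrE ?normc_ge0 // normc_sqr real_normK ?num_real //
  lerDl sqr_ge0.
Qed.

Lemma normIm x : `|Im x| <= normc x.
Proof.
by rewrite -(@ler_pXn2r _ 2) ?nnegrE ?normc_ge0 // normc_sqr real_normK ?num_real //
  lerDr sqr_ge0.
Qed.

Lemma normc_distC x y : normc (x - y) = normc (y - x).
Proof. by rewrite -normcN opprB. Qed.

Lemma lerB_normc x y : normc x - normc y <= normc (x - y).
Proof. by rewrite lerBlDr -{1}(subrK y x) le_normcD. Qed.

Lemma ler_dist_normc x y : `|normc x - normc y| <= normc (x - y).
Proof.
by rewrite ler_norml lerB_normc andbT lerNl opprB normc_distC lerB_normc.
Qed.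

Lemma normc_circle (t : R) : normc (circle_pt t) = 1.
Proof. by rewrite /= cos2Dsin2 sqrtr1. Qed.

Lemma normc_i : normc ('i : R[i]) = 1.
Proof. by rewrite /= expr0n add0r expr1n sqrtr1. Qed.

Lemma normc_numE x : `|x| = (normc x)%:C.
Proof. by []. Qed.

Lemma ball_normcP (z w : R[i]^o) (e : R) : ball z e%:C w <-> normc (w - z) < e.
Proof. by rewrite /ball /= -[X in X < _]/((normc _)%:C) ltcR normc_distC. Qed.

(** Balls of [R[i]^o] have radii in [R[i]]. A positive element of [R[i]] has zero imaginary part, so
    real radii give the same neighbourhoods. *)
Lemma nbhs_normcP (z : R[i]^o) (A : set R[i]^o) :
  nbhs z A <-> exists2 d : R, 0 < d & forall w, normc (w - z) < d -> A w.
Proof.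
split=> [/nbhs_ballP[e /= e0 H]|[d d0 H]].
  have eE : e = (complex.Re e)%:C.
    by apply: ReIm_eq => //=; move: e0; rewrite ltcE => /andP[/eqP].
  exists (complex.Re e); first by move: e0; rewrite ltcE => /andP[].
  by move=> w wz; apply: H; rewrite eE; apply/ball_normcP.
apply/nbhs_ballP; exists d%:C; first by rewrite /= ltcR.
by move=> w /ball_normcP; exact: H.
Qed.

(** The first-order expansion with real bounds and no division by [h]: the form in which derivatives
    are computed by hand for [cexp] and [schwarz]. *)
Lemma derivable_normcP f z :
  derivable (f : R[i]^o -> R[i]^o) z 1 <->
  exists c, forall e : R, 0 < e -> exists2 d : R, 0 < d &
    forall h, normc h < d -> normc (f (z + h) - f z - c * h) <= e * normc h.
Proof.
have E (c h : R[i]) : h != 0 -> normc (c - h^-1 * (f (h * 1 + z) - f z)) =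
    normc (f (z + h) - f z - c * h) / normc h.
  move=> h0; rewrite -normcV -normcM -normcN mulr1 [h + z]addrC; congr normc.
  rewrite mulrBl mulfK //; ring.
split=> [/cvg_ex[c]|[c H]].
  move/cvgrPdist_le => H; exists c => e e0.
  have e0' : 0 < e%:C :> R[i] by rewrite ltcR.
  have /nbhs_normcP[d d0 {}H] := H _ e0'; exists d => // h hd.
  have [->|h0] := eqVneq h 0.
    by rewrite addr0 subrr mulr0 subrr normc0 mulr0.
  have := H h; rewrite subr0 => /(_ hd h0); rewrite normc_numE lecR /=.
  by rewrite E // ler_pdivrMr // normc_gt0.
apply/cvg_ex; exists c; apply/cvgrPdist_le => e e0.
have eE : e = (complex.Re e)%:C.
  by apply: ReIm_eq => //=; move: e0; rewrite ltcE => /andP[/eqP].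
have e0' : 0 < complex.Re e by move: e0; rewrite ltcE => /andP[].
have [d d0 {}H] := H _ e0'; apply/nbhs_normcP; exists d => // h.
rewrite subr0 => hd h0; rewrite normc_numE eE lecR /= E //.
by rewrite ler_pdivrMr ?normc_gt0 //; exact: H.
Qed.

Lemma derivable_eq_near f g z (d : R) : 0 < d ->
  (forall w, normc (w - z) < d -> f w = g w) ->
  derivable (f : R[i]^o -> R[i]^o) z 1 -> derivable (g : R[i]^o -> R[i]^o) z 1.
Proof.
move=> d0 fg /derivable_normcP[c H]; apply/derivable_normcP; exists c => e e0.
have [d' d'0 {}H] := H e e0; exists (Num.min d d'); first by rewrite lt_min d0.
move=> h; rewrite lt_min => /andP[h1 h2].
by rewrite -!fg ?subrr ?normc0 // ?[z + h]addrC ?addrK // addrC; exact: H.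
Qed.

Lemma derivable_comp1 f g z : derivable (g : R[i]^o -> R[i]^o) z 1 ->
  derivable (f : R[i]^o -> R[i]^o) (g z) 1 ->
  derivable ((fun w => f (g w)) : R[i]^o -> R[i]^o) z 1.
Proof.
move=> /derivable1_diffP dg /derivable1_diffP df; apply/derivable1_diffP.
exact: (differentiable_comp dg df).
Qed.

Lemma cderivableM f g z : derivable (f : R[i]^o -> R[i]^o) z 1 ->
  derivable (g : R[i]^o -> R[i]^o) z 1 ->
  derivable ((fun w => f w * g w) : R[i]^o -> R[i]^o) z 1.
Proof. by move=> df dg; exact: (derivableM df dg). Qed.

Lemma cderivableMl (c : R[i]) f z : derivable (f : R[i]^o -> R[i]^o) z 1 ->
  derivable ((fun w => c * f w) : R[i]^o -> R[i]^o) z 1.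
Proof. by move=> df; exact: (cderivableM (derivable_cst _ _ _) df). Qed.

Lemma cderivable_affine (a b : R[i]) z :
  derivable ((fun w => a + b * w) : R[i]^o -> R[i]^o) z 1.
Proof.
apply: derivableD; first exact: derivable_cst.
apply: cderivableMl; exact: derivable_id.
Qed.

Lemma cderivable_div f g z : g z != 0 -> derivable (f : R[i]^o -> R[i]^o) z 1 ->
  derivable (g : R[i]^o -> R[i]^o) z 1 ->
  derivable ((fun w => f w / g w) : R[i]^o -> R[i]^o) z 1.
Proof.
by move=> gz df dg; exact: (cderivableM df (derivableV gz dg)).
Qed.

Lemma derivable_continuous f z : derivable (f : R[i]^o -> R[i]^o) z 1 ->
  {for z, continuous (f : R[i]^o -> R[i]^o)}.
Proof. by move=> /derivable1_diffP; exact: differentiable_continuous. Qed.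

Lemma within_normcP (A : set R[i]^o) v :
  {within A, continuous (v : R[i]^o -> R)} <->
  forall z, A z -> forall e, 0 < e -> exists2 d : R, 0 < d &
    forall w, A w -> normc (w - z) < d -> `|v w - v z| < e.
Proof.
split=> [/subspace_continuousP H z Az e e0|H].
  move: (H z Az) => /cvgrPdist_lt /(_ e e0).
  rewrite /within /= => /nbhs_normcP[d d0 {}H]; exists d => // w Aw wd.
  by rewrite distrC; exact: H.
apply/subspace_continuousP => z Az; apply/cvgrPdist_lt => e e0.
have [d d0 {}H] := H z Az e e0.
rewrite /within /=; apply/nbhs_normcP; exists d => // w wd Aw.
by rewrite distrC; exact: H.
Qed.

Lemma continuous_within_path (A : set R[i]^o) v (g : R -> R[i]) :
  {within A, continuous (v : R[i]^o -> R)} -> continuous (g : R -> R[i]^o) ->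
  (forall t, A (g t)) -> continuous (fun t => v (g t)).
Proof.
move=> /subspace_continuousP cv cg Ag t; apply/cvgrPdist_lt => e e0.
have := cv (g t) (Ag t); move/cvgrPdist_lt => /(_ e e0) H.
have {}H : nbhs (g t : R[i]^o) (fun w : R[i]^o => A w -> `|v (g t) - v w| < e) by [].
have {}H : \forall s \near t, A (g s) -> `|v (g t) - v (g s)| < e := cg t _ H.
near=> s; have : A (g s) -> `|v (g t) - v (g s)| < e by near: s.
by apply.
Unshelve. all: by end_near. Qed.

End complex_basics.

(** * Goursat's lemma *)

Section goursat.
Variable R : realType.
Local Notation mu := (@lebesgue_measure R).
Implicit Types (U V : R -> R -> R) (f g : R -> R).

Lemma integrable_itv f (a b : R) : {within `[a, b], continuous f} ->
  mu.-integrable `[a, b] (EFin \o f).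
Proof. by move=> cf; apply: continuous_compact_integrable => //; exact: segment_compact. Qed.

Lemma within_itvP f (a b : R) : (forall x, a <= x <= b -> {for x, continuous f}) ->
  {within `[a, b], continuous f}.
Proof.
move=> H; apply: continuous_in_subspaceT => x.
by rewrite inE /= in_itv /= => /H.
Qed.

Lemma Rintegral_itv_split f (a c b : R) : a <= c <= b ->
  {within `[a, b], continuous f} ->
  \int[mu]_(t in `[a, b]) f t =
  \int[mu]_(t in `[a, c]) f t + \int[mu]_(t in `[c, b]) f t.
Proof.
move=> /andP[ac cb] cf.
have If := integrable_itv cf.
have Icb : mu.-integrable `]c, b] (EFin \o f).
  by apply: integrableS If => //; apply: subset_itvr; rewrite bnd_simp.
by rewrite -(Rintegral_itv_obnd_cbnd Icb) -(Rintegral_itvB If) ?bnd_simp // subrKC.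
Qed.

Lemma within_Bcst f (a b c : R) : {within `[a, b], continuous f} ->
  {within `[a, b], continuous (fun t => f t - c)}.
Proof. by move=> cf x; apply: continuousB; [exact: cf|exact: cst_continuous]. Qed.

Lemma Rintegral_itv_cst (a b c : R) : a <= b ->
  \int[mu]_(t in `[a, b]) c = c * (b - a).
Proof.
move=> ab; rewrite Rintegral_cst //= lebesgue_measure_itv /= lte_fin.
by case: ltP => // ba; rewrite /= (_ : b = a) ?subrr //; apply/eqP; rewrite eq_le ab ba.
Qed.

Lemma Rintegral_itvBcst f (a b c : R) : a <= b ->
  {within `[a, b], continuous f} ->
  \int[mu]_(t in `[a, b]) (f t - c) = \int[mu]_(t in `[a, b]) f t - c * (b - a).
Proof.
move=> ab cf; rewrite RintegralB ?Rintegral_itv_cst //; first exact: integrable_itv.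
by apply: integrable_itv => x; exact: cst_continuous.
Qed.

Lemma Rintegral_itv_bound f (a b M : R) : a <= b ->
  {within `[a, b], continuous f} ->
  (forall t, a <= t <= b -> `|f t| <= M) ->
  `|\int[mu]_(t in `[a, b]) f t| <= M * (b - a).
Proof.
move=> ab cf fM; have If := integrable_itv cf.
apply: le_trans (le_normr_Rintegral _ If) _ => //.
rewrite -Rintegral_itv_cst //.
apply: le_Rintegral => //.
  by apply: integrable_itv => x; apply: continuous_comp; [exact: cf|exact: norm_continuous].
by apply: integrable_itv => x; exact: cst_continuous.
Qed.

(** The intervals [[u n, u n + L / 2 ^+ n]] are nested, so every left end is below every right end
    and the supremum of the left ends lies in all of them. *)
Lemma nested_itv (u : nat -> R) (L : R) : 0 <= L ->
  (forall n, u n <= u n.+1) ->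
  (forall n, u n.+1 + L / 2 ^+ n.+1 <= u n + L / 2 ^+ n) ->
  exists x, forall n, u n <= x <= u n + L / 2 ^+ n.
Proof.
move=> L0 uS uL.
have um n k : u n <= u (n + k)%N.
  by elim: k => [|k /le_trans]; rewrite ?addn0 // addnS; apply.
have uM n k : u (n + k)%N + L / 2 ^+ (n + k) <= u n + L / 2 ^+ n.
  by elim: k => [|k]; rewrite ?addn0 // addnS; apply: le_trans.
have pL n : 0 <= L / 2 ^+ n by rewrite divr_ge0 // exprn_ge0.
have ub m n : u m <= u n + L / 2 ^+ n.
  have [mn|/ltnW nm] := leqP m n.
    by apply: le_trans (um m (n - m)%N) _; rewrite subnKC // lerDl.
  by apply: le_trans (uM n (m - n)%N); rewrite subnKC // lerDl.
exists (sup (range u)) => n; apply/andP; split.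
  apply: ub_le_sup; last by exists n.
  by exists (u 0 + L / 2 ^+ 0) => _ [m _ <-]; exact: ub.
by apply: ge_sup; [exists (u 0), 0%N|move=> _ [m _ <-]; exact: ub].
Qed.

Lemma half_pow_lt (L d : R) : 0 <= L -> 0 < d -> exists n, L / 2 ^+ n < d.
Proof.
move=> L0 d0; exists (Num.bound (L / d)).
rewrite ltr_pdivrMr ?exprn_gt0 // mulrC -ltr_pdivrMr //.
apply: lt_trans (archi_boundP _) _; first by rewrite divr_ge0 // ltW.
by rewrite -natrX ltr_nat ltn_expl.
Qed.

Lemma half_split (L : R) n : L / 2 ^+ n = L / 2 ^+ n.+1 + L / 2 ^+ n.+1.
Proof. by rewrite exprS invfM; set X := (2 ^+ n)^-1; lra. Qed.

(** Goursat's argument for an abstract quantity [A x y n] attached to the rectangle with corner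
    [(x, y)] and sides [Lx / 2 ^+ n], [Ly / 2 ^+ n]. If [e = A x0 y0 0] were positive, quartering
    would give nested rectangles with [A >= e / 4 ^+ n], against the local bound at their common
    point. The right edge is tracked because the intended domain is a half plane bounded on the
    right. *)
Lemma bisection (A : R -> R -> nat -> R) (x0 y0 Lx Ly : R) : 0 <= Lx -> 0 <= Ly ->
  (forall x y n, x + Lx / 2 ^+ n <= x0 + Lx ->
    A x y n <= A x y n.+1 + A (x + Lx / 2 ^+ n.+1) y n.+1 +
      (A x (y + Ly / 2 ^+ n.+1) n.+1 +
       A (x + Lx / 2 ^+ n.+1) (y + Ly / 2 ^+ n.+1) n.+1)) ->
  (forall x y e, x <= x0 + Lx -> 0 < e -> exists2 d, 0 < d &
    forall x' y' n, x' <= x <= x' + Lx / 2 ^+ n -> y' <= y <= y' + Ly / 2 ^+ n ->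
      x' + Lx / 2 ^+ n <= x0 + Lx ->
      Lx / 2 ^+ n < d -> Ly / 2 ^+ n < d -> A x' y' n <= e / 4 ^+ n) ->
  A x0 y0 0%N <= 0.
Proof.
move=> Lx0 Ly0 sub loc; rewrite leNgt; apply/negP => A0.
pose e := A x0 y0 0%N.
have pL (L : R) n : 0 <= L -> 0 <= L / 2 ^+ n.
  by move=> ?; rewrite divr_ge0 // exprn_ge0.
(* Move to the first quarter that carries at least [e / 4 ^+ n.+1]. The fourth is the default: when
   the other three fall short, subadditivity forces it to carry that much. *)
pose st (n : nat) (p : R * R) : R * R :=
  let x := p.1 in let y := p.2 in
  let x' := x + Lx / 2 ^+ n.+1 in let y' := y + Ly / 2 ^+ n.+1 in
  if e / 4 ^+ n.+1 <= A x y n.+1 then (x, y) else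
  if e / 4 ^+ n.+1 <= A x' y n.+1 then (x', y) else
  if e / 4 ^+ n.+1 <= A x y' n.+1 then (x, y') else (x', y').
pose P := fix P n := if n is m.+1 then st m (P m) else (x0, y0).
have stx n p : p.1 <= (st n p).1 <= p.1 + Lx / 2 ^+ n.+1.
  by rewrite /st; do 3?case: ifP => _ /=; rewrite ?lexx ?lerDl ?pL.
have sty n p : p.2 <= (st n p).2 <= p.2 + Ly / 2 ^+ n.+1.
  by rewrite /st; do 3?case: ifP => _ /=; rewrite ?lexx ?lerDl ?pL.
have Px1 n : (P n).1 <= (P n.+1).1 by case/andP : (stx n (P n)).
have Py1 n : (P n).2 <= (P n.+1).2 by case/andP : (sty n (P n)).
have Px2 n : (P n.+1).1 + Lx / 2 ^+ n.+1 <= (P n).1 + Lx / 2 ^+ n.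
  by rewrite (half_split Lx n) addrA lerD2r; case/andP : (stx n (P n)).
have Py2 n : (P n.+1).2 + Ly / 2 ^+ n.+1 <= (P n).2 + Ly / 2 ^+ n.
  by rewrite (half_split Ly n) addrA lerD2r; case/andP : (sty n (P n)).
have Pin n : (P n).1 + Lx / 2 ^+ n <= x0 + Lx.
  by elim: n => [|n]; [rewrite /= expr0 divr1|exact/le_trans/Px2].
have PA n : e / 4 ^+ n <= A (P n).1 (P n).2 n.
  elim: n => [|n IH]; first by rewrite expr0 divr1.
  have := le_trans IH (sub _ _ _ (Pin n)).
  rewrite [P n.+1]/= /st.
  set a1 := A _ _ _; set a2 := A _ _ _; set a3 := A _ _ _; set a4 := A _ _ _.
  have -> : e / 4 ^+ n = 4 * (e / 4 ^+ n.+1) by rewrite exprS invfM mulrCA mulVKf.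
  set E := e / _; case: (leP E a1) => // h1; case: (leP E a2) => // h2.
  by case: (leP E a3) => // h3 /= h4; rewrite -/a4; lra.
have [xs xsP] := nested_itv Lx0 Px1 Px2.
have [ys ysP] := nested_itv Ly0 Py1 Py2.
have xsx : xs <= x0 + Lx.
  by have /andP[_ /le_trans] := xsP 0%N; apply; exact: Pin.
(* With [e / 2], the local bound [e / 2 / 4 ^+ n] strictly contradicts the invariant [PA]. *)
have e2 : 0 < e / 2 by rewrite divr_gt0.
have [d d0 H] := loc xs ys _ xsx e2.
have [n nd] := half_pow_lt (addr_ge0 Lx0 Ly0) d0.
have dx : Lx / 2 ^+ n < d.
  by apply: le_lt_trans nd; rewrite ler_pM2r ?invr_gt0 ?exprn_gt0 // lerDl.
have dy : Ly / 2 ^+ n < d.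
  by apply: le_lt_trans nd; rewrite ler_pM2r ?invr_gt0 ?exprn_gt0 // lerDr.
have := le_trans (PA n) (H _ _ _ (xsP n) (ysP n) (Pin n) dx dy).
by rewrite ler_pM2r ?invr_gt0 ?exprn_gt0 // -/e; lra.
Qed.

Definition diff2 U (x y p q : R) := forall e, 0 < e -> exists2 d, 0 < d &
  forall h k, `|h| < d -> `|k| < d ->
    `|U (x + h) (y + k) - U x y - (p * h + q * k)| <= e * (`|h| + `|k|).

Lemma near_dist_lt (x d : R) : 0 < d -> \forall z \near x, `|z - x| < d.
Proof.
by move=> d0; apply/nbhs_ballP; exists d => // z; rewrite /ball /= distrC.
Qed.

Lemma diff2_continuous1 U x y p q : diff2 U x y p q ->
  {for x, continuous (U ^~ y)} .
Proof.
move=> H; apply/cvgrPdist_lt => e e0.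
have [d d0 {}H] := H _ ltr01.
have K0 : 0 < 2 + `|p| by rewrite ltr_pwDl.
near=> z.
have zd : `|z - x| < d by near: z; exact: near_dist_lt.
have ze : `|z - x| < e / (2 + `|p|).
  by near: z; apply: near_dist_lt; rewrite divr_gt0.
have := H (z - x) 0 zd; rewrite normr0 => /(_ d0).
rewrite !addr0 mulr0 addr0 mul1r subrKC => {}H.
have : `|U z y - U x y| <= (1 + `|p|) * `|z - x|.
  rewrite -(subrK (p * (z - x)) (_ - _)) mulrDl mul1r -normrM.
  by apply: le_trans (ler_normD _ _) _; rewrite lerD2r.
rewrite distrC => /le_lt_trans; apply.
move: ze; rewrite ltr_pdivlMr // => ze.
apply: le_lt_trans ze; rewrite mulrC ler_wpM2l ?normr_ge0 //; lra.
Unshelve. all: by end_near. Qed.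

Lemma diff2_continuous2 U x y p q : diff2 U x y p q ->
  {for y, continuous (U x)}.
Proof.
move=> H; apply: (@diff2_continuous1 (fun y x => U x y) y x q p) => e e0.
have [d d0 {}H] := H e e0; exists d => // h k hd kd.
by rewrite [q * _ + _]addrC [`|h| + _]addrC; exact: H.
Qed.

(** For [U + i V] this is the imaginary part of its contour integral around the rectangle, opposite
    edges being grouped together. *)
Definition rect_flux U V x0 x1 y0 y1 :=
  \int[mu]_(y in `[y0, y1]) (U x1 y - U x0 y) -
  \int[mu]_(x in `[x0, x1]) (V x y1 - V x y0).

Section rectangle.
Variables (U V : R -> R -> R) (b : R).
(* Only [U_x = V_y] (the common [p]) is required, pointwise: no continuity of the
   partial derivatives.  For the real and imaginary parts of a holomorphic function
   this is one of the Cauchy-Riemann equations. *)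
Hypothesis UV : forall x y, x < b ->
  exists p q s, diff2 U x y p q /\ diff2 V x y s p.

Let cU x y0 y1 : x < b -> {within `[y0, y1], continuous (U x)}.
Proof.
move=> xb; apply: within_itvP => y _.
by have [p [q [s [H _]]]] := UV y xb; exact: diff2_continuous2 H.
Qed.

Let cV x0 x1 y : x1 < b -> {within `[x0, x1], continuous (V ^~ y)}.
Proof.
move=> xb; apply: within_itvP => x /andP[_ xx1].
by have [p [q [s [_ H]]]] := UV y (le_lt_trans xx1 xb); exact: diff2_continuous1 H.
Qed.

Let cUB x0 x1 y0 y1 : x0 <= x1 -> x1 < b ->
  {within `[y0, y1], continuous (fun y => U x1 y - U x0 y)}.
Proof.
move=> x01 x1b y; apply: continuousB; first exact: cU.
by apply: cU; exact: le_lt_trans x1b.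
Qed.

Let cVB x0 x1 y0 y1 : x1 < b ->
  {within `[x0, x1], continuous (fun x => V x y1 - V x y0)}.
Proof. by move=> x1b y; apply: continuousB; exact: cV. Qed.

Lemma rect_flux_splitx x0 x1 x2 y0 y1 : x0 <= x1 <= x2 -> x2 < b -> 
  rect_flux U V x0 x2 y0 y1 = rect_flux U V x0 x1 y0 y1 + rect_flux U V x1 x2 y0 y1.
Proof.
move=> /andP[x01 x12] x2b; have x1b := le_lt_trans x12 x2b.
have x0b := le_lt_trans x01 x1b.
rewrite /rect_flux (@Rintegral_itv_split _ x0 x1 x2) ?x01 //; last exact: cVB.
rewrite !RintegralB //; try by apply: integrable_itv; exact: cU.
- ring.
- by apply: integrable_itv; exact: cV.
- by apply: integrable_itv; exact: cV.
- by apply: integrable_itv; exact: cV.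
- by apply: integrable_itv; exact: cV.
Qed.

Lemma rect_flux_splity x0 x1 y0 y1 y2 : y0 <= y1 <= y2 -> x0 <= x1 -> x1 < b ->
  rect_flux U V x0 x1 y0 y2 = rect_flux U V x0 x1 y0 y1 + rect_flux U V x0 x1 y1 y2.
Proof.
move=> y012 x01 x1b; rewrite /rect_flux (Rintegral_itv_split y012); last exact: cUB.
have iV y : mu.-integrable `[x0, x1] (EFin \o V ^~ y).
  by apply: integrable_itv; exact: cV.
rewrite (RintegralB _ (iV y2) (iV y0)) // (RintegralB _ (iV y1) (iV y0)) //.
by rewrite (RintegralB _ (iV y2) (iV y1)) //; ring.
Qed.

(** Replace [U] and [V] by their first-order expansions at [(x, y)]: the affine parts contribute
    [p * l * m] to both integrals and cancel. The errors are at most [e * (l + m)] on edges of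
    lengths [l] and [m]. *)
Lemma rect_flux_local x y e : x < b -> 0 < e -> exists2 d, 0 < d &
  forall x' y' l m, x' <= x <= x' + l -> y' <= y <= y' + m -> x' + l < b ->
    l < d -> m < d ->
    `|rect_flux U V x' (x' + l) y' (y' + m)| <= e * (l + m) ^+ 2.
Proof.
move=> xb e0; have [p [q [s [HU HV]]]] := UV y xb.
have e2 : 0 < e / 2 by rewrite divr_gt0.
have [d1 d10 {}HU] := HU _ e2.
have [d2 d20 {}HV] := HV _ e2.
exists (Num.min d1 d2); first by rewrite lt_min d10.
move=> x' y' l m /andP[x1 x2] /andP[y1 y2] xlb; rewrite !lt_min.
move=> /andP[l1 l2] /andP[m1 m2].
have l0 : 0 <= l by lra.
have m0 : 0 <= m by lra.
have ER (W : R -> R -> R) d a c : (forall h k, `|h| < d -> `|k| < d ->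
    `|W (x + h) (y + k) - W x y - (a * h + c * k)| <= e / 2 * (`|h| + `|k|)) ->
    l < d -> m < d ->
    forall s t, x' <= s <= x' + l -> y' <= t <= y' + m ->
    `|W s t - W x y - (a * (s - x) + c * (t - y))| <= e / 2 * (l + m).
  move=> H ld md s' t /andP[s1 s2] /andP[t1 t2].
  have h1 : `|s' - x| <= l by rewrite ler_norml; lra.
  have k1 : `|t - y| <= m by rewrite ler_norml; lra.
  have := H (s' - x) (t - y) (le_lt_trans h1 ld) (le_lt_trans k1 md).
  rewrite !subrKC => /le_trans; apply.
  by rewrite ler_pM2l // lerD.
rewrite /rect_flux.
have IU : \int[mu]_(t in `[y', y' + m]) (U (x' + l) t - U x' t) = p * l * m +
    \int[mu]_(t in `[y', y' + m]) (U (x' + l) t - U x' t - p * l).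
  rewrite (@Rintegral_itvBcst (fun t => U (x' + l) t - U x' t)) ?lerDl //.
    by ring.
  by apply: cUB; rewrite ?lerDl.
have IV : \int[mu]_(t in `[x', x' + l]) (V t (y' + m) - V t y') = p * m * l +
    \int[mu]_(t in `[x', x' + l]) (V t (y' + m) - V t y' - p * m).
  rewrite (@Rintegral_itvBcst (fun t => V t (y' + m) - V t y')) ?lerDl //.
    by ring.
  exact: cVB.
rewrite IU IV [p * m * l]mulrAC opprD addrACA subrr add0r.
apply: le_trans (ler_normB _ _) _.
have -> : e * (l + m) ^+ 2 = e * (l + m) * (y' + m - y') + e * (l + m) * (x' + l - x').
  ring.
have tri (a c g : R) : `|a| <= g / 2 -> `|c| <= g / 2 -> `|a - c| <= g.
  by move=> h1 h2; apply: le_trans (ler_normB _ _) _; rewrite (splitr g) lerD.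
apply: lerD.
- apply: Rintegral_itv_bound; first by rewrite lerDl.
    by apply: within_Bcst; apply: cUB; rewrite ?lerDl.
  move=> t ht.
  have -> : U (x' + l) t - U x' t - p * l =
    (U (x' + l) t - U x y - (p * (x' + l - x) + q * (t - y))) -
    (U x' t - U x y - (p * (x' - x) + q * (t - y))) by ring.
  by apply: tri; rewrite mulrAC; apply: (ER U) HU _ _ _ _ _ _ => //; lra.
- apply: Rintegral_itv_bound; first by rewrite lerDl.
    by apply: within_Bcst; exact: cVB.
  move=> t ht.
  have -> : V t (y' + m) - V t y' - p * m =
    (V t (y' + m) - V x y - (s * (t - x) + p * (y' + m - y))) -
    (V t y' - V x y - (s * (t - x) + p * (y' - y))) by ring.
  by apply: tri; rewrite mulrAC; apply: (ER V) HV _ _ _ _ _ _ => //; lra.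
Qed.

Lemma goursat x0 x1 y0 y1 : x0 <= x1 -> x1 < b -> y0 <= y1 ->
  rect_flux U V x0 x1 y0 y1 = 0.
Proof.
move=> x01 x1b y01.
pose A x y (n : nat) := `|rect_flux U V x (x + (x1 - x0) / 2 ^+ n) y
  (y + (y1 - y0) / 2 ^+ n)|.
have pL (L : R) n : 0 <= L -> 0 <= L / 2 ^+ n.
  by move=> ?; rewrite divr_ge0 // exprn_ge0.
have Lx0 : 0 <= x1 - x0 by rewrite subr_ge0.
have Ly0 : 0 <= y1 - y0 by rewrite subr_ge0.
have : A x0 y0 0%N <= 0.
  apply: (@bisection A x0 y0 (x1 - x0) (y1 - y0)) => //.
  - move=> x y n; rewrite subrKC => xn; rewrite /A (half_split (x1 - x0) n) (half_split (y1 - y0) n).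
    rewrite (half_split (x1 - x0) n) in xn.
    have := pL _ n.+1 Lx0; have := pL _ n.+1 Ly0.
    move: xn; set l := _ / _; set m := _ / _ => xn m0 l0.
    rewrite (addrA x) (addrA y).
    rewrite (@rect_flux_splity _ _ _ (y + m)); [|lra|lra|lra].
    rewrite (@rect_flux_splitx _ (x + l) _ y); [|lra|lra].
    rewrite (@rect_flux_splitx _ (x + l) _ (y + m)); [|lra|lra].
    apply: le_trans (ler_normD _ _) _.
    by apply: lerD; exact: ler_normD.
  - move=> x y e; rewrite subrKC => xx1 e0.
    (* The local bound with [e / K] is [e / K] times the squared sum of the sides, divided by
       [4 ^+ n]; the [1] keeps [K] positive for a degenerate rectangle. *)
    pose K := ((x1 - x0) + (y1 - y0)) ^+ 2 + 1.
    have K0 : 0 < K by rewrite ltr_wpDl ?sqr_ge0.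
    have eK : 0 < e / K by rewrite divr_gt0.
    have [d d0 H] := rect_flux_local y (le_lt_trans xx1 x1b) eK.
    exists d => // x' y' n hx hy hb hl hm.
    apply: le_trans (H _ _ _ _ hx hy (le_lt_trans hb x1b) hl hm) _.
    rewrite -mulrDl exprMn -exprVn exprAC (_ : 2^-1 ^+ 2 = 4^-1); last first.
      by rewrite exprVn; congr (_^-1); rewrite -natrX.
    rewrite exprVn mulrA ler_pM2r ?invr_gt0 ?exprn_gt0 //.
    rewrite mulrAC ler_pdivrMr // ler_pM2l // /K lerDl //.
by rewrite /A expr0 !divr1 !subrKC normr_le0 => /eqP.
Qed.

End rectangle.
End goursat.

(** * Circle means and the complex exponential *)

Section circle_means.
Variable R : realType.
Local Notation mu := (@lebesgue_measure R).
Local Notation Re := (@complex.Re R).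
Local Notation Im := (@complex.Im R).
Implicit Types (g h v : R[i] -> R) (F : R[i] -> R[i]).

Definition rmean g : R := (2 * pi)^-1 * \int[mu]_(t in `[0, 2 * pi]) g (circle_pt t).

Definition ccont g := continuous (fun t : R => g (circle_pt t)).

Lemma twopi_gt0 : 0 < 2 * pi :> R. Proof. by rewrite mulr_gt0 ?pi_gt0. Qed.

Lemma ccont_integrable g : ccont g ->
  mu.-integrable `[0, 2 * pi] (EFin \o (fun t => g (circle_pt t))).
Proof. by move=> cg; apply: integrable_itv; apply: within_itvP => x _; exact: cg. Qed.

Lemma ccont_cst (c : R) : ccont (fun=> c).
Proof. by move=> t; exact: cst_continuous. Qed.
Arguments ccont_cst : clear implicits.

Lemma ccontD g h : ccont g -> ccont h -> ccont (fun z => g z + h z).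
Proof. by move=> cg ch t; apply: continuousD; [exact: cg|exact: ch]. Qed.

Lemma ccontB g h : ccont g -> ccont h -> ccont (fun z => g z - h z).
Proof. by move=> cg ch t; apply: continuousB; [exact: cg|exact: ch]. Qed.

Lemma ccontM g h : ccont g -> ccont h -> ccont (fun z => g z * h z).
Proof. by move=> cg ch t; apply: continuousM; [exact: cg|exact: ch]. Qed.

Lemma ccont_comp (f : R -> R) g : (forall t, {for g (circle_pt t), continuous f}) ->
  ccont g -> ccont (fun z => f (g z)).
Proof.
move=> cf cg t; apply: (@continuous_comp _ _ _ (fun t => g (circle_pt t)) f).
  exact: cg.
exact: cf.
Qed.

Lemma eq_ccont g h : (forall z, normc z = 1 -> g z = h z) -> ccont g -> ccont h.
Proof.
move=> gh; rewrite /ccont.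
suff -> : (fun t : R => g (circle_pt t)) = (fun t => h (circle_pt t)) by [].
by apply/funext => t; rewrite gh // normc_circle.
Qed.

Lemma eq_rmean g h : (forall z, normc z = 1 -> g z = h z) -> rmean g = rmean h.
Proof.
move=> gh; congr (_ * _); apply: eq_Rintegral => t _.
by rewrite gh // normc_circle.
Qed.

Lemma rmean_cst (c : R) : rmean (fun=> c) = c.
Proof.
rewrite /rmean Rintegral_itv_cst ?ltW ?twopi_gt0 // subr0 mulrC mulfK //.
by rewrite gt_eqF ?twopi_gt0.
Qed.

Lemma rmeanD g h : ccont g -> ccont h -> rmean (fun z => g z + h z) = rmean g + rmean h.
Proof.
move=> cg ch; rewrite /rmean -mulrDr; congr (_ * _).
by apply: RintegralD => //; exact: ccont_integrable.
Qed.

Lemma rmeanB g h : ccont g -> ccont h -> rmean (fun z => g z - h z) = rmean g - rmean h.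
Proof.
move=> cg ch; rewrite /rmean -mulrBr; congr (_ * _).
by apply: RintegralB => //; exact: ccont_integrable.
Qed.

Lemma rmeanZ (c : R) g : ccont g -> rmean (fun z => c * g z) = c * rmean g.
Proof.
move=> cg; rewrite /rmean mulrCA; congr (_ * _).
by apply: RintegralZl => //; exact: ccont_integrable.
Qed.

Lemma le_rmean g h : ccont g -> ccont h ->
  (forall z, normc z = 1 -> g z <= h z) -> rmean g <= rmean h.
Proof.
move=> cg ch gh; rewrite /rmean ler_pM2l ?invr_gt0 ?twopi_gt0 //.
apply: le_Rintegral => //; [exact: ccont_integrable|exact: ccont_integrable|].
by move=> t _; apply: gh; exact: normc_circle.
Qed.

Lemma rmean_ge0 g : (forall z, normc z = 1 -> 0 <= g z) -> 0 <= rmean g.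
Proof.
move=> g0; rewrite /rmean mulr_ge0 ?invr_ge0 ?(ltW twopi_gt0) //.
by apply: Rintegral_ge0 => t _; apply: g0; exact: normc_circle.
Qed.

Lemma rmean_dist_le g (c M : R) : ccont g ->
  (forall z, normc z = 1 -> `|g z - c| <= M) -> `|rmean g - c| <= M.
Proof.
move=> cg H; have HM z : normc z = 1 -> c - M <= g z <= c + M.
  by move=> /H; rewrite ler_norml; lra.
have := le_rmean (ccont_cst (c - M)) cg (fun z z1 => proj1 (andP (HM z z1))).
have := le_rmean cg (ccont_cst (c + M)) (fun z z1 => proj2 (andP (HM z z1))).
by rewrite !rmean_cst ler_norml; lra.
Qed.

Lemma circle_path_continuous (z0 c : R[i]) :
  continuous (fun t : R => z0 + c * circle_pt t : R[i]^o).
Proof.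
move=> t; have := @circle_pt_continuous R 1 t.
move/cvgrPdist_lt => H; apply/cvgrPdist_lt => e e0.
have c1 : 0 < normc c + 1 by rewrite ltr_wpDl ?normc_ge0.
have c1' : 0 < (normc c + 1)%:C by rewrite ltcR.
have {}H := H (e / (normc c + 1)%:C) (divr_gt0 e0 c1').
near=> s; have : `|1%:C * circle_pt t - 1%:C * circle_pt s| < e / (normc c + 1)%:C.
  by near: s; exact: H.
rewrite ltr_pdivlMr // !mul1r => K.
have -> : z0 + c * circle_pt t - (z0 + c * circle_pt s) =
    c * (circle_pt t - circle_pt s) by ring.
rewrite normrM; apply: le_lt_trans K; rewrite mulrC ler_wpM2l //.
by rewrite normc_numE lecR lerDl.
Unshelve. all: by end_near. Qed.

Lemma ccont_within (A : set R[i]^o) v (z0 c : R[i]) :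
  {within A, continuous (v : R[i]^o -> R)} ->
  (forall z, normc z = 1 -> A (z0 + c * z)) -> ccont (fun z => v (z0 + c * z)).
Proof.
move=> cv Ac; apply: (@continuous_within_path _ A v (fun t => z0 + c * circle_pt t) cv).
  exact: circle_path_continuous.
by move=> t; apply: Ac; rewrite normc_circle.
Qed.

Lemma within_derivable (A : set R[i]^o) F (v : R[i] -> R) :
  (forall x y, `|v x - v y| <= normc (x - y)) ->
  (forall z, A z -> derivable (F : R[i]^o -> R[i]^o) z 1) ->
  {within A, continuous ((fun z => v (F z)) : R[i]^o -> R)}.
Proof.
move=> lv dF; apply/within_normcP => z Az e e0.
have /derivable_continuous/cvgrPdist_lt := dF z Az.
have e0' : 0 < e%:C :> R[i] by rewrite ltcR.
move=> /(_ _ e0')/nbhs_normcP[d d0 H]; exists d => // w Aw wz.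
have := H w wz; rewrite normc_numE ltcR normc_distC; exact: le_lt_trans.
Qed.

Lemma lip_Re x y : `|Re x - Re y| <= normc (x - y).
Proof. by rewrite -cReN -cReD normRe. Qed.

Lemma lip_Im x y : `|Im x - Im y| <= normc (x - y).
Proof. by rewrite -cImN -cImD normIm. Qed.

Lemma within_subset (A B : set R[i]^o) v : A `<=` B ->
  {within B, continuous (v : R[i]^o -> R)} -> {within A, continuous (v : R[i]^o -> R)}.
Proof. by move=> AB; exact: continuous_subspaceW. Qed.

End circle_means.

Section cexp.
Variable R : realType.
Local Notation Re := (@complex.Re R).
Local Notation Im := (@complex.Im R).

Definition cexp (z : R[i]) : R[i] := (expR (Re z))%:C * circle_pt (Im z).

Lemma cexpD x y : cexp (x + y) = cexp x * cexp y.
Proof.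
rewrite /cexp cReD cImD expRD; apply: ReIm_eq; rewrite !ReImE /= ?cosD ?sinD; ring.
Qed.

Lemma normc_cexp z : normc (cexp z) = expR (Re z).
Proof. by rewrite normcM normc_circle mulr1 normcR ger0_norm ?expR_ge0. Qed.

Lemma is_derive0_approx (f : R -> R) (c : R) : is_derive (0 : R) 1 f c ->
  forall e, 0 < e -> exists2 d : R, 0 < d &
  forall h, `|h| < d -> `|f h - f 0 - c * h| <= e * `|h|.
Proof.
move=> [df <-] e e0; move: df => /cvg_ex[l /= fl].
have -> : 'D_1 f 0 = l by apply: cvg_lim fl.
move/cvgrPdist_le : fl => /(_ e e0)/nbhs_ballP[d /= d0 H]; exists d => // h hd.
have [->|h0] := eqVneq h 0; first by rewrite subrr mulr0 subr0 normr0 mulr0.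
have := H h; rewrite /ball /= sub0r normrN => /(_ hd h0).
rewrite addr0 /GRing.scale /= mulr1 => K.
have -> : f h - f 0 - l * h = - (l - h^-1 * (f h - f 0)) * h.
  by field.
by rewrite normrM normrN ler_wpM2r.
Qed.

Lemma derivable_cexp z : derivable (cexp : R[i]^o -> R[i]^o) z 1.
Proof.
apply/derivable_normcP; exists (cexp z) => e e0.
have E0 : 0 < expR (Re z) := expR_gt0 _.
(* The bounds [A1] and [A2] below add up to [9 * e1 * n], so 16 leaves a margin. The factor
   [expR (Re z)] is the modulus of [cexp z], which [cexpD] splits off to reduce the expansion to the
   origin. *)
have [e1 [e10 e1le1 e1le]] : exists e1, [/\ 0 < e1, e1 <= 1 & e1 * 16 <= e / expR (Re z)].
  exists (Num.min 1 (e / expR (Re z) / 16)).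
  split; first by rewrite lt_min ltr01 !divr_gt0.
    by rewrite ge_min lexx.
  by rewrite -ler_pdivlMr // ge_min lexx orbT.
have [d1 d10 H1] := is_derive0_approx (is_derive_expR (0 : R)) e10.
have [d2 d20 H2] := is_derive0_approx (is_derive_sin (0 : R)) e10.
have [d3 d30 H3] := is_derive0_approx (is_derive_cos (0 : R)) e10.
rewrite expR0 in H1; rewrite cos0 sin0 in H2; rewrite sin0 cos0 in H3.
pose d := Num.min (Num.min d1 d2) (Num.min d3 (Num.min 1 e1)).
exists d; first by rewrite !lt_min d10 d20 d30 ltr01 e10.
move=> h; rewrite !lt_min => /andP[/andP[hd1 hd2]/and3P[hd3 h1 he1]].
have -> : cexp (z + h) - cexp z - cexp z * h = cexp z * (cexp h - 1 - h).
  by rewrite cexpD; ring.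
rewrite normcM normc_cexp mulrC -ler_pdivlMr //.
have hx := normRe h; have hy := normIm h; have hn := normc_ge0 h.
move: hx hy (H1 _ (le_lt_trans hx hd1)) (H2 _ (le_lt_trans hy hd2))
  (H3 _ (le_lt_trans hy hd3)).
rewrite mul1r subr0 mul1r oppr0 mul0r subr0.
set x := Re h; set y := Im h; set n := normc h in hn h1 he1 *.
move=> hx hy Hx Hs Hc.
apply: le_trans (normc_le_ReIm _) _; rewrite !ReImE /= -/x -/y !mul0r !subr0 ?addr0 ?add0r.
have Ex : `|expR x - 1| <= 2 * n.
  rewrite -(subrK x (_ - _)); apply: le_trans (ler_normD _ _) _.
  have : e1 * `|x| <= 1 * n by apply: ler_pM => //; exact: ltW.
  lra.
have Ex3 : expR x <= 3.
  have : expR x - 1 <= 2 * n by apply: le_trans (ler_norm _) Ex.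
  lra.
have Ex0 := expR_ge0 x.
have A1 : `|expR x * cos y - 1 - x| <= e1 * n + 3 * (e1 * n).
  have -> : expR x * cos y - 1 - x = (expR x - 1 - x) + expR x * (cos y - 1) by ring.
  apply: le_trans (ler_normD _ _) _; apply: lerD.
    by apply: le_trans Hx _; rewrite ler_pM2l.
  rewrite normrM ger0_norm //; apply: ler_pM => //.
  by apply: le_trans Hc _; rewrite ler_pM2l.
have A2 : `|expR x * sin y - y| <= 3 * (e1 * n) + 2 * e1 * n.
  have -> : expR x * sin y - y = expR x * (sin y - y) + (expR x - 1) * y by ring.
  apply: le_trans (ler_normD _ _) _; apply: lerD.
    rewrite normrM ger0_norm //; apply: ler_pM => //.
    by apply: le_trans Hs _; rewrite ler_pM2l.
  rewrite normrM; apply: ler_pM => //; apply: le_trans Ex _.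
  by rewrite ler_pM2l // ltW.
apply: le_trans (lerD A1 A2) _.
have : e1 * 16 * n <= e / expR (Re z) * n by rewrite ler_wpM2r.
have : 0 <= e1 * n by rewrite mulr_ge0 // ltW.
rewrite mulrAC; lra.
Qed.

End cexp.

(** * Mean value property and maximum principle *)

Section mean_value.
Variable R : realType.
Local Notation mu := (@lebesgue_measure R).
Local Notation Re := (@complex.Re R).
Local Notation Im := (@complex.Im R).
Implicit Types (v : R[i] -> R) (F : R[i] -> R[i]).

Lemma derivable_diff2 (G : R[i] -> R[i]) (x y : R) :
  derivable (G : R[i]^o -> R[i]^o) (x +i* y) 1 ->
  exists p q s, diff2 (fun x y => Re (G (x +i* y))) x y p q /\
    diff2 (fun x y => Im (G (x +i* y))) x y s p.
Proof.
move=> /derivable_normcP[c H]; exists (Re c), (- Im c), (Im c).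
have K e : 0 < e -> exists2 d : R, 0 < d & forall h k, `|h| < d -> `|k| < d ->
    normc (G ((x + h) +i* (y + k)) - G (x +i* y) - c * (h +i* k)) <= e * (`|h| + `|k|).
  move=> e0; have [d d0 {}H] := H e e0; exists (d / 2); first by rewrite divr_gt0.
  move=> h k hd kd; have hk : normc (h +i* k) <= `|h| + `|k| by exact: normc_le_ReIm.
  apply: (le_trans (H (h +i* k) _)); last by rewrite ler_pM2l.
  by apply: le_lt_trans hk _; lra.
split=> e /K[d d0 {}K]; exists d => // h k hd kd; apply: le_trans (K h k hd kd).
  by apply: le_trans (normRe _); rewrite !ReImE /= mulNr.
by apply: le_trans (normIm _); rewrite !ReImE /= [X in _ - X]addrC.
Qed.

Lemma within_disc F v : (forall x y, `|v x - v y| <= normc (x - y)) ->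
  analytic_on_disc F -> {within (@disc R : set R[i]^o), continuous ((fun z => v (F z)) : R[i]^o -> R)}.
Proof. by move=> lv aF; exact: within_derivable. Qed.

Lemma cexp_circle (x y : R) : cexp (x +i* y) = (expR x)%:C * circle_pt y.
Proof. by []. Qed.

Lemma disc_cexp (x y : R) : x < 0 -> disc (cexp (x +i* y)).
Proof. by move=> x0; rewrite /disc /mkset normc_cexp /= expR_lt1. Qed.

Lemma disc_scale (r : R) z : 0 <= r < 1 -> normc z = 1 -> disc (r%:C * z).
Proof. by move=> /andP[r0 r1] z1; rewrite /disc /mkset normcM z1 mulr1 normcR ger0_norm. Qed.

(** Through [cexp] the annulus becomes the rectangle with sides [[ln r, ln s]] and [[0, 2 pi]]. The
    horizontal edges cancel by periodicity, so the vanishing flux equates the vertical edges, which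
    are the two circle integrals. *)
Lemma rmean_constant F (r s : R) : analytic_on_disc F -> 0 < r <= s -> s < 1 ->
  rmean (fun z => Re (F (r%:C * z))) = rmean (fun z => Re (F (s%:C * z))).
Proof.
move=> aF /andP[r0 rs] s1.
have s0 : 0 < s := lt_le_trans r0 rs.
pose G z := F (cexp z).
have UV x y : x < 0 -> exists p q s, diff2 (fun x y => Re (G (x +i* y))) x y p q /\
    diff2 (fun x y => Im (G (x +i* y))) x y s p.
  move=> x0; apply: derivable_diff2; apply: derivable_comp1; first exact: derivable_cexp.
  exact/aF/disc_cexp.
have lrs : ln r <= ln s by rewrite ler_ln ?posrE.
have ls : ln s < 0 by rewrite ln_lt0 // s0.
have := goursat UV lrs ls (ltW (twopi_gt0 R)).
rewrite /rect_flux.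
have -> : \int[mu]_(x in `[ln r, ln s]) (Im (G (x +i* (2 * pi))) - Im (G (x +i* 0))) = 0.
  rewrite (_ : (fun x => _) = fun=> 0).
    by rewrite Rintegral_itv_cst // mul0r.
  apply/funext => x; rewrite /G !cexp_circle /circle_pt mulr_natl.
  by rewrite cos2pi sin2pi cos0 sin0 subrr.
rewrite subr0 => H; apply/eqP; rewrite eq_sym -subr_eq0 -rmeanB.
- rewrite /rmean; apply/eqP; move: H.
  under eq_Rintegral do rewrite /G !cexp_circle !lnK ?posrE //.
  by move=> ->; rewrite mulr0.
- have := @ccont_within _ (@disc R) (fun z => Re (F z)) 0 s%:C (within_disc (@lip_Re R) aF).
  move=> K; apply: eq_ccont (K _) => z z1; rewrite ?add0r //.
  by apply: disc_scale => //; rewrite ltW.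
- have := @ccont_within _ (@disc R) (fun z => Re (F z)) 0 r%:C (within_disc (@lip_Re R) aF).
  move=> K; apply: eq_ccont (K _) => z z1; rewrite ?add0r //.
  by apply: disc_scale => //; rewrite ltW //= (le_lt_trans rs).
Qed.

Lemma ccont_disc F v (z0 c : R[i]) : (forall x y, `|v x - v y| <= normc (x - y)) ->
  analytic_on_disc F -> normc z0 + normc c < 1 -> ccont (fun z => v (F (z0 + c * z))).
Proof.
move=> lv aF zc; apply: (@ccont_within _ (@disc R) (fun z => v (F z))).
  exact: within_disc.
move=> z z1; apply: le_lt_trans zc.
by apply: le_trans (le_normcD _ _) _; rewrite normcM z1 mulr1.
Qed.

Lemma ccont_disc0 F v (r : R) : (forall x y, `|v x - v y| <= normc (x - y)) ->
  analytic_on_disc F -> 0 <= r < 1 -> ccont (fun z => v (F (r%:C * z))).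
Proof.
move=> lv aF /andP[r0 r1].
have := @ccont_disc F v 0 r%:C lv aF; rewrite normc0 add0r normcR ger0_norm // => /(_ r1).
by apply: eq_ccont => z _; rewrite add0r.
Qed.

(** The mean does not depend on the radius, and on small circles it is close to the value at the
    centre by continuity. *)
Lemma mean_value F (r : R) : analytic_on_disc F -> 0 <= r < 1 ->
  rmean (fun z => Re (F (r%:C * z))) = Re (F 0).
Proof.
move=> aF /andP[]; rewrite le_eqVlt => /predU1P[<- _|r0 r1].
  by rewrite -[RHS]rmean_cst; apply: eq_rmean => z _; rewrite mul0r.
apply/eqP; rewrite -subr_eq0 -normr_le0; apply/ler_addgt0Pr => e e0; rewrite add0r.
have D0 : disc (0 : R[i]) by rewrite /disc /mkset normc0.
have /within_normcP/(_ _ D0 e e0)[d d0 H] := within_disc (@lip_Re R) aF.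
pose q := Num.min (d / 2) r.
have q0 : 0 < q by rewrite lt_min r0 divr_gt0.
have qr : q <= r by rewrite ge_min lexx orbT.
have qd : q < d by rewrite gt_min; apply/orP; left; lra.
rewrite -(@rmean_constant F q r) // ?q0 //.
have q01 : 0 <= q < 1 by rewrite ltW //= (le_lt_trans qr).
apply: rmean_dist_le; first exact: ccont_disc0 (@lip_Re R) aF q01.
move=> z z1; apply/ltW/H; first exact: disc_scale.
by rewrite subr0 normcM z1 mulr1 normcR gtr0_norm.
Qed.

End mean_value.

Section max_principle.
Variable R : realType.
Local Notation Re := (@complex.Re R).
Local Notation Im := (@complex.Im R).
Implicit Types (v : R[i] -> R) (F : R[i] -> R[i]).

Lemma complexRM (a b : R) : (a * b)%:C = a%:C * b%:C. Proof. exact: rmorphM. Qed.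

Lemma complexRV (a : R) : (a^-1)%:C = (a%:C)^-1. Proof. exact: fmorphV. Qed.

Definition cdisc : set R[i]^o := [set z | normc z <= 1].
Definition circle : set R[i]^o := [set z | normc z = 1].

Lemma disc_cdisc z : disc z -> cdisc z. Proof. exact: ltW. Qed.
Lemma circle_cdisc : circle `<=` cdisc. Proof. by rewrite /circle /cdisc => z /= ->. Qed.

Lemma complex_continuous : continuous ((fun p => p.1 +i* p.2) : R * R -> R[i]^o).
Proof.
move=> p; apply/cvgrPdist_lt => -[e e']; rewrite ltcE /= => /andP[/eqP -> e0].
have e20 : 0 < e / 2 by rewrite divr_gt0.
have c1 : fst @ p --> p.1 by exact: cvg_fst.
have c2 : snd @ p --> p.2 by exact: cvg_snd.
move/cvgrPdist_lt : c1 => /(_ _ e20) c1.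
move/cvgrPdist_lt : c2 => /(_ _ e20) c2.
near=> q; rewrite -[X in X < _]/((normc _)%:C) ltcR (splitr e).
apply: le_lt_trans (normc_le_ReIm _) _ => /=.
by rewrite ltrD //; near: q.
Unshelve. all: by end_near. Qed.

Lemma compact_cdisc : compact cdisc.
Proof.
pose K : set (R * R) := (`[-1, 1] `*` `[-1, 1]) `&` (fun p => p.1 ^+ 2 + p.2 ^+ 2) @^-1` [set x | x <= 1].
have cK : compact K.
  apply: compact_closedI; first by apply: compact_setX; exact: segment_compact.
  apply: closed_comp; last exact: closed_le.
  have cf : continuous (fst : R * R -> R) by move=> p; exact: cvg_fst.
  have cs : continuous (snd : R * R -> R) by move=> p; exact: cvg_snd.
  by move=> p _; apply: cvgD; rewrite expr2; under eq_cvg do rewrite expr2; apply: cvgM; do ?[exact: cf|exact: cs].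
suff -> : cdisc = (fun p => p.1 +i* p.2) @` K.
  by apply: continuous_compact => //; apply: continuous_subspaceT; exact: complex_continuous.
have E (a b : R) : (normc (a +i* b) <= 1) = (a ^+ 2 + b ^+ 2 <= 1).
  have <- : normc (a +i* b) ^+ 2 = a ^+ 2 + b ^+ 2 by rewrite normc_sqr.
  by rewrite expr_le1 ?normc_ge0.
apply/seteqP; split=> [[a b]|z [[a b] [_ /= H] <-]]; last by rewrite /cdisc /= E.
rewrite /cdisc /mkset => H; exists (a, b) => //.
split; last by rewrite /= -E.
have := le_trans (normRe _) H; have := le_trans (normIm _) H.
by rewrite /= !in_itv /= !ler_norml.
Qed.

Lemma compact_circle : compact circle.
Proof.
suff -> : circle = cdisc `&` (fun z : R[i]^o => normc z) @^-1` [set x | x >= 1].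
  apply: compact_closedI; first exact: compact_cdisc.
  apply: closed_comp; last exact: closed_ge.
  by move=> z _; exact: normc_continuous.
apply/seteqP; split=> [z|z []]; rewrite /circle /cdisc /= ?/mkset.
  by move=> ->.
by move=> a b; apply/eqP; rewrite eq_le a.
Qed.

Lemma withinD (A : set R[i]^o) (v w : R[i] -> R) :
  {within A, continuous (v : R[i]^o -> R)} -> {within A, continuous (w : R[i]^o -> R)} ->
  {within A, continuous ((fun z => v z + w z) : R[i]^o -> R)}.
Proof.
move=> /subspace_continuousP cv /subspace_continuousP cw.
apply/subspace_continuousP => z Az; apply: cvgD; [exact: cv|exact: cw].
Qed.

Lemma withinM (A : set R[i]^o) (v w : R[i] -> R) :
  {within A, continuous (v : R[i]^o -> R)} -> {within A, continuous (w : R[i]^o -> R)} ->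
  {within A, continuous ((fun z => v z * w z) : R[i]^o -> R)}.
Proof.
move=> /subspace_continuousP cv /subspace_continuousP cw.
apply/subspace_continuousP => z Az; apply: cvgM; [exact: cv|exact: cw].
Qed.

Lemma within_comp (A : set R[i]^o) (f : R -> R) (v : R[i] -> R) : continuous f ->
  {within A, continuous (v : R[i]^o -> R)} ->
  {within A, continuous ((fun z => f (v z)) : R[i]^o -> R)}.
Proof.
move=> cf /subspace_continuousP cv.
by apply/subspace_continuousP => z Az; apply: (cvg_comp _ _ (cv z Az)); exact: cf.
Qed.

Lemma within_cst (A : set R[i]^o) (c : R) : {within A, continuous ((fun=> c) : R[i]^o -> R)}.
Proof. by apply: continuous_subspaceT => z; exact: cst_continuous. Qed.

Lemma within_normc (A : set R[i]^o) : {within A, continuous (@normc R : R[i]^o -> R)}.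
Proof. by apply: continuous_subspaceT; exact: normc_continuous. Qed.

Lemma cdisc_max v : {within cdisc, continuous (v : R[i]^o -> R)} ->
  exists2 z, cdisc z & forall w, cdisc w -> v w <= v z.
Proof.
move=> cv; have [|z] := compact_EVT_max _ compact_cdisc cv.
  by exists 0; rewrite /cdisc /mkset normc0 ler01.
rewrite inE => z1 H; exists z => // w w1; apply: H; by rewrite inE.
Qed.

Lemma circle_bounded v : {within circle, continuous (v : R[i]^o -> R)} ->
  exists2 M, 0 <= M & forall z, normc z = 1 -> `|v z| <= M.
Proof.
move=> cv.
have cv' := within_comp (@norm_continuous _ R) cv.
have [|z] := compact_EVT_max _ compact_circle cv'.
  by exists 1; rewrite /circle /mkset normc1.
rewrite inE => z1 H; exists `|v z| => // w w1; apply: H; by rewrite inE.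
Qed.

(** Subharmonicity in its local form, the admissible radii depending on the point. This suffices for
    the maximum principle and can be checked separately on each side of a gluing. *)
Definition submean v z := exists2 d : R, 0 < d &
  forall s, 0 < s < d -> v z <= rmean (fun w => v (z + s%:C * w)).

Section local_mean.
Variables (F : R[i] -> R[i]) (z0 : R[i]) (d : R).
Hypothesis d0 : 0 < d.
Hypothesis dF : forall w, normc (w - z0) < d -> derivable (F : R[i]^o -> R[i]^o) w 1.

Lemma analytic_rescale : analytic_on_disc (fun z => F (z0 + d%:C * z)).
Proof.
move=> z dz; apply: (@derivable_comp1 _ F); first exact: cderivable_affine.
by apply: dF; rewrite addrC addKr normcM normcR gtr0_norm // -[ltRHS]mulr1 ltr_pM2l.
Qed.

Let scaleE (s : R) z : z0 + d%:C * ((s / d)%:C * z) = z0 + s%:C * z.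
Proof. by rewrite mulrA -complexRM [d * _]mulrC divfK // gt_eqF. Qed.

Let s_d s : 0 <= s < d -> 0 <= s / d < 1.
Proof. by move=> /andP[s0 sd]; rewrite divr_ge0 ?(ltW d0) //= ltr_pdivrMr // mul1r. Qed.

Lemma mean_value_local s : 0 <= s < d ->
  rmean (fun z => Re (F (z0 + s%:C * z))) = Re (F z0).
Proof.
move=> /s_d sd; have := mean_value analytic_rescale sd.
rewrite mulr0 addr0 => <-; apply: eq_rmean => z _; by rewrite scaleE.
Qed.

Lemma ccont_local v s : (forall x y, `|v x - v y| <= normc (x - y)) -> 0 <= s < d ->
  ccont (fun z => v (F (z0 + s%:C * z))).
Proof.
move=> lv /s_d sd; have := ccont_disc0 lv analytic_rescale sd.
by apply: eq_ccont => z _; rewrite scaleE.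
Qed.

End local_mean.

(** Rotate by the unimodular [u] for which [u * F z0] is the modulus of [F z0], and apply the mean
    value property to [Re (u * F)], which is at most [|F|]. *)
Lemma norm_mean_local F z0 (d s : R) : 0 < d ->
  (forall w, normc (w - z0) < d -> derivable (F : R[i]^o -> R[i]^o) w 1) ->
  0 <= s < d -> normc (F z0) <= rmean (fun z => normc (F (z0 + s%:C * z))).
Proof.
move=> d0 dF sd.
have [F0|F0] := eqVneq (F z0) 0.
  by rewrite F0 normc0; apply: rmean_ge0 => z _; exact: normc_ge0.
pose u := conjc (F z0) / (normc (F z0))%:C.
have n0 : 0 < normc (F z0) by rewrite normc_gt0.
have nJ : normc (conjc (F z0)) = normc (F z0).
  by case: (F z0) => a b /=; rewrite sqrrN.
have u1 : normc u = 1.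
  by rewrite normcM normcV nJ normcR gtr0_norm // divff ?gt_eqF.
have uF : Re (u * F z0) = normc (F z0).
  rewrite /u mulrAC -[X in X / _]/(conjc (F z0) * F z0).
  have -> : conjc (F z0) * F z0 = ((normc (F z0)) ^+ 2)%:C.
    apply: ReIm_eq; rewrite ?normc_sqr; case: (F z0) => a b /=; ring.
  by rewrite -complexRV -complexRM expr2 mulfK // gt_eqF.
have duF w : normc (w - z0) < d -> derivable ((fun w => u * F w) : R[i]^o -> R[i]^o) w 1.
  by move=> /dF; exact: cderivableMl.
rewrite -uF -(mean_value_local d0 duF sd); apply: le_rmean.
- exact: (ccont_local d0 duF (@lip_Re R) sd).
- exact: (ccont_local d0 dF (@ler_dist_normc R) sd).
move=> z _; apply: le_trans (ler_norm _) _; apply: le_trans (normRe _) _.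
by rewrite normcM u1 mul1r.
Qed.

Lemma ccont_Re_linear (c : R[i]) : ccont (fun z => Re (c * z)).
Proof.
have dc w : normc (w - 0) < 2 -> derivable ((fun w => c * w) : R[i]^o -> R[i]^o) w 1.
  by move=> _; apply: cderivableMl; exact: derivable_id.
have s1 : 0 <= (1 : R) < 2 by lra.
have := ccont_local (ltr0Sn _ 1) dc (@lip_Re R) s1.
by apply: eq_ccont => z _; rewrite add0r mul1r.
Qed.

Lemma rmean_Re_linear (c : R[i]) : rmean (fun z => Re (c * z)) = 0.
Proof.
have dc w : normc (w - 0) < 2 -> derivable ((fun w => c * w) : R[i]^o -> R[i]^o) w 1.
  by move=> _; apply: cderivableMl; exact: derivable_id.
have s1 : 0 <= (1 : R) < 2 by lra.
have := mean_value_local (ltr0Sn _ 1) dc s1; rewrite mulr0 => H; rewrite -[RHS]/(Re 0) -H.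
by apply: eq_rmean => z _; rewrite add0r mul1r.
Qed.

Lemma normcD_sqr (a : R[i]) (s : R) z : normc z = 1 ->
  normc (a + s%:C * z) ^+ 2 = normc a ^+ 2 + s ^+ 2 + 2 * s * Re (conjc a * z).
Proof.
move=> z1; have : Re z ^+ 2 + Im z ^+ 2 = 1 by rewrite -normc_sqr z1 expr1n.
rewrite !normc_sqr !ReImE /=; case: a z {z1} => a b [x y] /= H.
have -> : s ^+ 2 = s ^+ 2 * (x ^+ 2 + y ^+ 2) by rewrite H mulr1.
ring.
Qed.

(* A maximum of [v + e |z|^2] cannot be interior, since the circle means of [|z|^2]
   strictly exceed its value at the centre. *)
Lemma max_principle v (m : R) : {within cdisc, continuous (v : R[i]^o -> R)} ->
  (forall z, disc z -> submean v z) -> (forall z, normc z = 1 -> v z <= m) ->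
  forall z, cdisc z -> v z <= m.
Proof.
move=> cv sv vm w w1; apply/ler_addgt0Pr => e e0.
have cu : {within cdisc, continuous ((fun z => v z + e * normc z ^+ 2) : R[i]^o -> R)}.
  apply: withinD => //; apply: withinM; first exact: within_cst.
  have c2 : continuous (fun x : R => x ^+ 2) by exact: exprn_continuous.
  exact: (within_comp c2 (@within_normc _)).
have [z z1 zmax] := cdisc_max cu.
have {z1}[z1|z1] : normc z = 1 \/ disc z.
  by move: z1; rewrite /cdisc /disc /= le_eqVlt => /predU1P; case; [left|right].
  have := zmax w w1; have := vm z z1; rewrite z1 expr1n mulr1.
  have : 0 <= e * normc w ^+ 2 by rewrite mulr_ge0 ?sqr_ge0 ?ltW.
  lra.
have [d d0 H] := sv z z1.
have z1' : 0 < 1 - normc z by rewrite subr_gt0.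
pose s := Num.min d (1 - normc z) / 2.
have m0 : 0 < Num.min d (1 - normc z) by rewrite lt_min d0.
have s0 : 0 < s by rewrite divr_gt0.
have sm : s < Num.min d (1 - normc z) by rewrite /s; lra.
move: sm; rewrite lt_min => /andP[sd sz].
have {}H : v z <= rmean (fun w => v (z + s%:C * w)) by apply: H; rewrite s0.
have inD u : normc u = 1 -> cdisc (z + s%:C * u).
  move=> u1; rewrite /cdisc /=; apply: le_trans (le_normcD _ _) _.
  by rewrite normcM u1 mulr1 normcR gtr0_norm //; lra.
(* Maximality at [z] bounds [v (z + s u)] by this function. Its linear term has mean zero, so the
   mean of [v] is at most [v z - e * s ^+ 2], against [H]. *)
have cl : ccont (fun u => (v z - e * s ^+ 2) - e * (2 * s) * Re (conjc z * u)).
  apply: ccontB; first exact: ccont_cst.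
  by apply: ccontM; [exact: ccont_cst|exact: ccont_Re_linear].
have : rmean (fun w => v (z + s%:C * w)) <=
    rmean (fun u => (v z - e * s ^+ 2) - e * (2 * s) * Re (conjc z * u)).
  apply: le_rmean => //; first exact: ccont_within cv inD.
  move=> u u1; have := zmax _ (inD u u1); rewrite (normcD_sqr _ _ u1); lra.
rewrite rmeanB ?rmean_cst ?rmeanZ ?rmean_Re_linear; last first.
- by apply: ccontM; [exact: ccont_cst|exact: ccont_Re_linear].
- exact: ccont_cst.
- exact: ccont_Re_linear.
have : 0 < e * s ^+ 2 by rewrite mulr_gt0 // exprn_gt0.
lra.
Qed.

End max_principle.

(** * The Poisson and Schwarz integrals *)

Section poisson.
Variable R : realType.
Local Notation Re := (@complex.Re R).
Local Notation Im := (@complex.Im R).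
Implicit Types (k v : R[i] -> R) (s F : R[i] -> R[i]) (w z : R[i]).

Lemma Re_div x y : Re (x / y) = (Re x * Re y + Im x * Im y) / normc y ^+ 2.
Proof. rewrite normc_sqr; case: x y => a b [c d] /=; ring. Qed.

Lemma conjc_circle z : normc z = 1 -> conjc z = z^-1.
Proof.
move=> z1; have z0 : z != 0 by rewrite -normc_gt0 z1 ltr01.
apply: (mulfI z0); rewrite mulfV //; have := normc_sqr z; rewrite z1 expr1n.
case: z {z0 z1} => a b /= H; apply: ReIm_eq => /=; last by ring.
by rewrite H; ring.
Qed.

Lemma circle_sub_neq0 w z : disc w -> normc z = 1 -> z - w != 0.
Proof.
move=> w1 z1; rewrite subr_eq0; apply/eqP => zw.
by move: w1; rewrite /disc /= -zw z1 ltxx.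
Qed.

Lemma ccont_derivable s v : (forall x y, `|v x - v y| <= normc (x - y)) ->
  (forall z, normc z = 1 -> derivable (s : R[i]^o -> R[i]^o) z 1) ->
  ccont (fun z => v (s z)).
Proof.
move=> lv ds; have cv := @within_derivable _ (@circle R) s v lv ds.
have := @ccont_within _ _ (fun z => v (s z)) 0 1 cv => K.
by apply: eq_ccont (K _) => z z1; rewrite /circle /= add0r mul1r.
Qed.

Lemma within_circle_ccont v : {within @circle R, continuous (v : R[i]^o -> R)} -> ccont v.
Proof.
move=> cv; have := @ccont_within _ _ v 0 1 cv => K.
by apply: eq_ccont (K _) => z z1; rewrite /circle /= add0r mul1r.
Qed.

(** The mean of the complex function [k * s], assembled from two real integrals. *)
Definition kmean k s : R[i] :=
  rmean (fun z => k z * Re (s z)) +i* rmean (fun z => k z * Im (s z)).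

Definition ccont2 s := ccont (fun z => Re (s z)) /\ ccont (fun z => Im (s z)).

(** The combination is that of a first-order remainder, as needed to differentiate under the
    mean. *)
Lemma kmean_linear k s1 s2 s3 (h : R[i]) : ccont k -> ccont2 s1 -> ccont2 s2 -> ccont2 s3 ->
  kmean k (fun z => s1 z - s2 z - s3 z * h) = kmean k s1 - kmean k s2 - kmean k s3 * h.
Proof.
move=> ck [c1 d1] [c2 d2] [c3 d3].
have cM (g : R[i] -> R) : ccont g -> ccont (fun z => k z * g z) by exact: ccontM.
have cZ (c : R) (g : R[i] -> R) : ccont g -> ccont (fun z => c * (k z * g z)).
  by move=> cg; apply: ccontM; [exact: ccont_cst|exact: cM].
apply: ReIm_eq; rewrite !ReImE /=.
  transitivity (rmean (fun z => (k z * Re (s1 z) - k z * Re (s2 z)) -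
      (Re h * (k z * Re (s3 z)) - Im h * (k z * Im (s3 z))))).
    by apply: eq_rmean => z _; rewrite !ReImE; ring.
  rewrite !rmeanB ?rmeanZ; do ?[exact: cM|exact: cZ|apply: ccontB]; ring.
transitivity (rmean (fun z => (k z * Im (s1 z) - k z * Im (s2 z)) -
    (Im h * (k z * Re (s3 z)) + Re h * (k z * Im (s3 z))))).
  by apply: eq_rmean => z _; rewrite !ReImE; ring.
rewrite !rmeanB ?rmeanD ?rmeanZ; do ?[exact: cM|exact: cZ|apply: ccontB|apply: ccontD]; ring.
Qed.

Lemma rmeanM_bound k (g : R[i] -> R) (C : R) : ccont k -> ccont g ->
  (forall z, normc z = 1 -> `|g z| <= C) ->
  `|rmean (fun z => k z * g z)| <= C * rmean (fun z => `|k z|).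
Proof.
move=> ck cg gC; have cn := ccont_comp (fun t => @norm_continuous _ R _) ck.
have H z : normc z = 1 -> `|k z * g z| <= C * `|k z|.
  by move=> z1; rewrite normrM mulrC ler_wpM2r // gC.
have cC : ccont (fun z => C * `|k z|) by apply: ccontM => //; exact: ccont_cst.
have cN : ccont (fun z => - C * `|k z|) by apply: ccontM => //; exact: ccont_cst.
rewrite ler_norml -mulNr -!rmeanZ //; apply/andP; split; apply: le_rmean => //.
- exact: ccontM.
- by move=> z /H; rewrite ler_norml mulNr => /andP[].
- exact: ccontM.
- by move=> z /H; rewrite ler_norml => /andP[].
Qed.

Lemma normc_kmean k s (C : R) : ccont k -> ccont2 s ->
  (forall z, normc z = 1 -> normc (s z) <= C) ->
  normc (kmean k s) <= 2 * C * rmean (fun z => `|k z|).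
Proof.
move=> ck [c1 c2] sC; apply: le_trans (normc_le_ReIm _) _ => /=.
rewrite [2 * C]mulr_natl mulr2n mulrDl; apply: lerD; apply: rmeanM_bound => // z z1.
  exact: le_trans (normRe _) (sC z z1).
exact: le_trans (normIm _) (sC z z1).
Qed.

Definition schwarz_kernel w z := (z + w) / (z - w).

Definition poisson_kernel w z := Re (schwarz_kernel w z).

Definition schwarz k w := kmean k (schwarz_kernel w).

Definition poisson k w := rmean (fun z => k z * poisson_kernel w z).

Lemma Re_schwarz k w : Re (schwarz k w) = poisson k w. Proof. by []. Qed.

Lemma ccont2_derivable s :
  (forall z, normc z = 1 -> derivable (s : R[i]^o -> R[i]^o) z 1) -> ccont2 s.
Proof.
by move=> ds; split; apply: ccont_derivable ds; [exact: lip_Re|exact: lip_Im].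
Qed.

Lemma cderivable_addr (a : R[i]) z : derivable ((fun z => z + a) : R[i]^o -> R[i]^o) z 1.
Proof. by apply: derivableD; [exact: derivable_id|exact: derivable_cst]. Qed.

Lemma ccont2_schwarz_kernel w : disc w -> ccont2 (schwarz_kernel w).
Proof.
move=> w1; apply: ccont2_derivable => z z1.
apply: cderivable_div; [exact: circle_sub_neq0|exact: cderivable_addr|].
exact: cderivable_addr.
Qed.

Lemma ccont_poisson_kernel w : disc w -> ccont (poisson_kernel w).
Proof. by move=> /ccont2_schwarz_kernel[]. Qed.

Lemma circle_sub_ge w z : normc z = 1 -> 1 - normc w <= normc (z - w).
Proof. by move=> z1; rewrite -z1 lerB_normc. Qed.

(** Differentiation under the mean: [s'] is the derivative of the kernel in [w], and the remainder
    [2 z h^2 / ((z - w)^2 (z - w - h))] is of order [|h|^2] uniformly on the circle. *)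
Lemma derivable_schwarz k w : ccont k -> disc w ->
  derivable (schwarz k : R[i]^o -> R[i]^o) w 1.
Proof.
move=> ck w1; apply/derivable_normcP.
pose s' z := (2 * z) / ((z - w) * (z - w)).
exists (kmean k s') => e e0.
pose r := 1 - normc w; have r0 : 0 < r by rewrite subr_gt0.
pose K := rmean (fun z => `|k z|).
have K0 : 0 <= K by apply: rmean_ge0.
(* The remainder is at most [4 / r ^+ 3 * normc h ^+ 2], since [z - w] is bounded below by [r] and
   [z - (w + h)] by [r / 2]; [normc_kmean] doubles it. The [1] covers [K = 0]. *)
pose C := 8 / r ^+ 3 * K + 1.
have C0 : 0 < C by rewrite ltr_wpDl // mulr_ge0 // divr_ge0 // exprn_ge0 // ltW.
exists (Num.min (r / 2) (e / C)); first by rewrite lt_min !divr_gt0.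
move=> h; rewrite lt_min => /andP[hr he].
have hn := normc_ge0 h.
have wh1 : disc (w + h).
  rewrite /disc /=; apply: le_lt_trans (le_normcD _ _) _; rewrite /r in hr r0 *; lra.
have cs' : ccont2 s'.
  apply: ccont2_derivable => z z1; apply: cderivable_div.
  - by rewrite mulf_neq0 // circle_sub_neq0.
  - by apply: cderivableMl; exact: derivable_id.
  - by apply: cderivableM; exact: cderivable_addr.
have := kmean_linear h ck (ccont2_schwarz_kernel wh1) (ccont2_schwarz_kernel w1) cs'.
rewrite -/(schwarz k (w + h)) -/(schwarz k w) => <-.
have cL : ccont2 (fun z => schwarz_kernel (w + h) z - schwarz_kernel w z - s' z * h).
  have [[[a b] [c d]] [f g]] := (ccont2_schwarz_kernel wh1, ccont2_schwarz_kernel w1, cs').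
  split.
    apply: (@eq_ccont _ (fun z => Re (schwarz_kernel (w + h) z) - Re (schwarz_kernel w z) -
      (Re (s' z) * Re h - Im (s' z) * Im h))) => [z _|]; first by rewrite !ReImE.
    by do !apply: ccontB => //; apply: ccontM => //; exact: ccont_cst.
  apply: (@eq_ccont _ (fun z => Im (schwarz_kernel (w + h) z) - Im (schwarz_kernel w z) -
      (Re (s' z) * Im h + Im (s' z) * Re h))) => [z _|]; first by rewrite !ReImE.
  by do !apply: ccontB => //; apply: ccontD; apply: ccontM => //; exact: ccont_cst.
have B z : normc z = 1 ->
    normc (schwarz_kernel (w + h) z - schwarz_kernel w z - s' z * h) <= 4 / r ^+ 3 * normc h ^+ 2.
  move=> z1; have zw := circle_sub_neq0 w1 z1; have zwh := circle_sub_neq0 wh1 z1.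
  have -> : schwarz_kernel (w + h) z - schwarz_kernel w z - s' z * h =
      2 * z * h * h / ((z - w) * (z - w) * (z - (w + h))).
    by rewrite /schwarz_kernel /s'; field; rewrite zwh zw.
  rewrite normcM normcV !normcM z1 (_ : normc (2 : R[i]) = 2); last first.
    by rewrite -[2]/(2%:R) -(rmorph_nat (real_complex R)) normcR ger0_norm.
  have h1 : r <= normc (z - w) by exact: circle_sub_ge.
  have h2 : r / 2 <= normc (z - (w + h)).
    have := circle_sub_ge (w + h) z1; have := le_normcD w h.
    rewrite /r in hr *; lra.
  have r20 : 0 < r / 2 by rewrite divr_gt0.
  have p0 := lt_le_trans r0 h1; have q0 := lt_le_trans r20 h2.
  have -> : 4 / r ^+ 3 * normc h ^+ 2 = 2 * 1 * normc h * normc h * (r * r * (r / 2))^-1.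
    by field; rewrite gt_eqF.
  rewrite ler_wpM2l ?mulr_ge0 // lef_pV2 ?posrE ?mulr_gt0 //.
  have r0' := ltW r0; have r20' := ltW r20.
  apply: ler_pM => //; first exact: mulr_ge0.
  exact: ler_pM.
apply: le_trans (normc_kmean ck cL B) _; rewrite -/K.
have -> : 2 * (4 / r ^+ 3 * normc h ^+ 2) * K = 8 / r ^+ 3 * K * normc h * normc h by ring.
apply: ler_wpM2r => //; rewrite ltr_pdivlMr // in he; apply: le_trans (ltW he).
by rewrite mulrC ler_wpM2l // /C lerDl.
Qed.

Lemma schwarz_bound k w (C : R) : ccont k -> disc w ->
  (forall z, normc z = 1 -> `|k z| <= C) ->
  normc (schwarz k w) <= 4 / (1 - normc w) * C.
Proof.
move=> ck w1 kC; have r0 : 0 < 1 - normc w by rewrite subr_gt0.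
have B z : normc z = 1 -> normc (schwarz_kernel w z) <= 2 / (1 - normc w).
  move=> z1; rewrite normcM normcV; apply: ler_pM; rewrite ?invr_ge0 ?normc_ge0 //.
    apply: le_trans (le_normcD _ _) _; rewrite z1; lra.
  by rewrite lef_pV2 ?posrE // ?normc_gt0 ?circle_sub_neq0 // circle_sub_ge.
apply: le_trans (normc_kmean ck (ccont2_schwarz_kernel w1) B) _.
rewrite (_ : 2 * (2 / (1 - normc w)) = 4 / (1 - normc w)); last by field; rewrite gt_eqF.
rewrite ler_pM2l ?divr_gt0 // -[leRHS]rmean_cst; apply: le_rmean => //.
  exact: (ccont_comp (fun t => @norm_continuous _ R _) ck).
exact: ccont_cst.
Qed.

Lemma poisson_kernelE w z : disc w -> normc z = 1 ->
  poisson_kernel w z = (1 - normc w ^+ 2) / normc (z - w) ^+ 2.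
Proof.
move=> w1 z1; rewrite /poisson_kernel /schwarz_kernel Re_div; congr (_ / _).
have := normc_sqr z; rewrite z1 expr1n normc_sqr !ReImE => ->; ring.
Qed.

Lemma poisson_kernel_ge0 w z : disc w -> normc z = 1 -> 0 <= poisson_kernel w z.
Proof.
move=> w1 z1; rewrite poisson_kernelE // divr_ge0 ?sqr_ge0 // subr_ge0.
by rewrite expr_le1 ?normc_ge0 // ltW.
Qed.

(** With the next lemma, Harnack's bounds [(1 + |w|) / (1 - |w|)] and [(1 - |w|) / (1 + |w|)],
    simplified by [|w| < 1]. *)
Lemma poisson_kernel_ub w z : disc w -> normc z = 1 ->
  poisson_kernel w z <= 2 / (1 - normc w).
Proof.
move=> w1 z1; rewrite poisson_kernelE //; have r0 : 0 < 1 - normc w by rewrite subr_gt0.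
have n0 := normc_ge0 w.
apply: (@le_trans _ _ ((1 - normc w ^+ 2) / (1 - normc w) ^+ 2)).
  rewrite ler_wpM2l ?subr_ge0 ?expr_le1 // ?(ltW w1) //.
  rewrite lef_pV2 ?posrE ?exprn_gt0 // ?normc_gt0 ?circle_sub_neq0 //.
  by rewrite lerXn2r ?nnegrE ?normc_ge0 ?(ltW r0) // circle_sub_ge.
have -> : (1 - normc w ^+ 2) / (1 - normc w) ^+ 2 = (1 + normc w) / (1 - normc w).
  by field; rewrite gt_eqF.
rewrite ler_pM2r ?invr_gt0 //; have : normc w < 1 by []. lra.
Qed.

Lemma poisson_kernel_lb w z : disc w -> normc z = 1 ->
  (1 - normc w) / 2 <= poisson_kernel w z.
Proof.
move=> w1 z1; rewrite poisson_kernelE //; have r0 : 0 < 1 - normc w by rewrite subr_gt0.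
have n0 := normc_ge0 w; have w2 : normc w < 1 by [].
apply: (@le_trans _ _ ((1 - normc w ^+ 2) / (1 + normc w) ^+ 2)).
  have -> : (1 - normc w ^+ 2) / (1 + normc w) ^+ 2 = (1 - normc w) / (1 + normc w).
    by field; rewrite gt_eqF //; lra.
  rewrite ler_pM2l // lef_pV2 ?posrE; lra.
rewrite ler_wpM2l ?subr_ge0 ?expr_le1 // ?(ltW w1) //.
rewrite lef_pV2 ?posrE ?exprn_gt0 // ?normc_gt0 ?circle_sub_neq0 //; last by lra.
rewrite lerXn2r ?nnegrE ?normc_ge0 //; first by lra.
by have := le_normcD z (- w); rewrite normcN z1.
Qed.

End poisson.

(** * Reproducing properties and boundary behaviour of the Poisson integral *)

Section poisson2.
Variable R : realType.
Local Notation Re := (@complex.Re R).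
Local Notation Im := (@complex.Im R).
Implicit Types (k v : R[i] -> R) (s F : R[i] -> R[i]) (w z : R[i]).

(** On the unit circle this is the conjugate of the Schwarz kernel. It is holomorphic in [z] near
    the closed disc and equals 1 at 0, so the mean of [F * conj_kernel w] can be read off at the
    centre. *)
Definition conj_kernel w z := (1 + conjc w * z) / (1 - conjc w * z).

Lemma normc_conj w : normc (conjc w) = normc w.
Proof. by case: w => a b /=; rewrite sqrrN. Qed.

Lemma conj_kernel_derivable w z : normc w * normc z < 1 ->
  derivable (conj_kernel w : R[i]^o -> R[i]^o) z 1.
Proof.
move=> wz; apply: cderivable_div.
- rewrite subr_eq0; apply/eqP => E; move: wz.
  by rewrite -(normc_conj w) -normcM -E normc1 ltxx.
- exact: cderivable_affine.
- have := @cderivable_affine R 1 (- conjc w) z.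
  by under eq_fun do rewrite mulNr.
Qed.

Lemma schwarz_kernel_conj w z : disc w -> normc z = 1 ->
  schwarz_kernel w z = conjc (conj_kernel w z).
Proof.
move=> w1 z1; have zw := circle_sub_neq0 w1 z1.
have z0 : z != 0 by rewrite -normc_gt0 z1 ltr01.
rewrite /conj_kernel rmorphM fmorphV rmorphD rmorphB !rmorphM rmorph1 /= conjcK.
rewrite conjc_circle // /schwarz_kernel; field.
by rewrite z0 zw.
Qed.

Lemma mean_unit F (d : R) : 1 < d ->
  (forall z, normc z < d -> derivable (F : R[i]^o -> R[i]^o) z 1) ->
  ccont (fun z => Re (F z)) /\ rmean (fun z => Re (F z)) = Re (F 0).
Proof.
move=> d1 dF; have d0 : 0 < d := lt_trans ltr01 d1.
have dF' z : normc (z - 0) < d -> derivable (F : R[i]^o -> R[i]^o) z 1.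
  by rewrite subr0; exact: dF.
have s1 : 0 <= (1 : R) < d by lra.
split; first by apply: eq_ccont (ccont_local d0 dF' (@lip_Re R) s1) => z _; rewrite add0r mul1r.
by rewrite -(mean_value_local d0 dF' s1); apply: eq_rmean => z _; rewrite add0r mul1r.
Qed.

Lemma mean_conj_kernel F w (d : R) : disc w -> 1 < d ->
  (forall z, normc z < d -> derivable (F : R[i]^o -> R[i]^o) z 1) ->
  ccont (fun z => Re (F z * conj_kernel w z)) /\
  rmean (fun z => Re (F z * conj_kernel w z)) = Re (F 0).
Proof.
move=> w1 d1 dF; have w2 : normc w < 1 by []; have n0 := normc_ge0 w.
(* This radius lies beyond the unit circle but short of [1 / |w|], the modulus of the pole of the
   kernel; written this way it also covers [w = 0]. *)
have d2 : 1 < 2 / (1 + normc w) by rewrite ltr_pdivlMr; lra.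
have E0 : F 0 * conj_kernel w 0 = F 0.
  by rewrite /conj_kernel mulr0 addr0 subr0 divr1 mulr1.
have dm : 1 < Num.min d (2 / (1 + normc w)) by rewrite lt_min d1.
rewrite -[X in _ = Re X]E0; apply: (mean_unit dm) => z; rewrite lt_min => /andP[zd zw].
apply: cderivableM; first exact: dF.
apply: conj_kernel_derivable; apply: (@le_lt_trans _ _ (normc w * (2 / (1 + normc w)))).
  by rewrite ler_wpM2l // ltW.
by rewrite mulrA ltr_pdivrMr; lra.
Qed.

Lemma ltr1_2 : 1 < 2 :> R. Proof. lra. Qed.

Lemma poisson_one w : disc w -> rmean (poisson_kernel w) = 1.
Proof.
move=> w1; have [|_ H] := @mean_conj_kernel (fun=> 1) w 2 w1 ltr1_2.
  by move=> z _; exact: derivable_cst.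
transitivity (rmean (fun z => Re (1 * conj_kernel w z))); last exact: H.
apply: eq_rmean => z z1.
by rewrite mul1r /poisson_kernel schwarz_kernel_conj //; case: (conj_kernel w z).
Qed.

(** With [S] the Schwarz kernel, [c z S = c z + c w + c w S]. Hence [Re (c z) * Re S] is half a sum
    of four terms with known means: two vanish and two equal [Re (c w)]. *)
Lemma poisson_Re_linear (c : R[i]) w : disc w -> poisson (fun z => Re (c * z)) w = Re (c * w).
Proof.
move=> w1.
have dl (a : R[i]) z : derivable ((fun z => a * z) : R[i]^o -> R[i]^o) z 1.
  by apply: cderivableMl; exact: derivable_id.
have [c1 m1] : ccont (fun z => Re (c * z * conj_kernel w z)) /\
    rmean (fun z => Re (c * z * conj_kernel w z)) = Re (c * 0).
  by apply: (@mean_conj_kernel (fun z => c * z) w 2 w1 ltr1_2) => z _; exact: dl.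
have [c2 m2] : ccont (fun z => Re (conjc (c * w) * conj_kernel w z)) /\
    rmean (fun z => Re (conjc (c * w) * conj_kernel w z)) = Re (conjc (c * w)).
  by apply: (@mean_conj_kernel (fun=> conjc (c * w)) w 2 w1 ltr1_2) => z _; exact: derivable_cst.
have c3 := @ccont_Re_linear R c.
transitivity (rmean (fun z => 2^-1 * ((Re (c * z * conj_kernel w z) + Re (c * z)) +
    (Re (conjc (c * w) * conj_kernel w z) + Re (c * w))))).
  apply: eq_rmean => z z1; rewrite /poisson_kernel.
  have E : c * z * schwarz_kernel w z = c * z + c * w + c * w * schwarz_kernel w z.
    by rewrite /schwarz_kernel; field; exact: circle_sub_neq0.
  have : Re (c * z * schwarz_kernel w z) =
      Re (c * z) + Re (c * w) + Re (c * w * schwarz_kernel w z) by rewrite E !cReD.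
  rewrite schwarz_kernel_conj //.
  move: (c * z) (c * w) (conj_kernel w z) => [a b] [a' b'] [g g'] /=; lra.
rewrite rmeanZ ?rmeanD ?rmean_cst ?m1 ?m2 ?rmean_Re_linear ?mulr0.
- by rewrite (_ : Re (conjc _) = Re (c * w)) /=; [lra|case: (c * w)].
- exact: c2.
- exact: ccont_cst.
- exact: c1.
- exact: c3.
- by apply: ccontD.
- by apply: ccontD => //; exact: ccont_cst.
- by apply: ccontD; apply: ccontD => //; exact: ccont_cst.
Qed.

Section poisson_algebra.
Variable w : R[i].
Hypothesis w1 : disc w.

Lemma ccont_poisson k : ccont k -> ccont (fun z => k z * poisson_kernel w z).
Proof. by move=> ck; apply: ccontM => //; exact: ccont_poisson_kernel. Qed.

Lemma poisson_cst (c : R) : poisson (fun=> c) w = c.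
Proof. by rewrite /poisson rmeanZ ?poisson_one ?mulr1 //; exact: ccont_poisson_kernel. Qed.

Lemma poissonD k1 k2 : ccont k1 -> ccont k2 ->
  poisson (fun z => k1 z + k2 z) w = poisson k1 w + poisson k2 w.
Proof.
move=> c1 c2; rewrite /poisson -rmeanD; do ?exact: ccont_poisson.
by apply: eq_rmean => z _; rewrite mulrDl.
Qed.

Lemma poissonZ (c : R) k : ccont k -> poisson (fun z => c * k z) w = c * poisson k w.
Proof.
move=> c1; rewrite /poisson -rmeanZ; last exact: ccont_poisson.
by apply: eq_rmean => z _; rewrite mulrA.
Qed.

Lemma le_poisson k1 k2 : ccont k1 -> ccont k2 ->
  (forall z, normc z = 1 -> k1 z <= k2 z) -> poisson k1 w <= poisson k2 w.
Proof.
move=> c1 c2 k12; apply: le_rmean; do ?exact: ccont_poisson.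
by move=> z z1; rewrite ler_wpM2r ?poisson_kernel_ge0 // k12.
Qed.

Lemma poisson_le_mean k : ccont k -> (forall z, normc z = 1 -> 0 <= k z) ->
  poisson k w <= 2 / (1 - normc w) * rmean k.
Proof.
move=> ck k0; rewrite -rmeanZ //; apply: le_rmean; first exact: ccont_poisson.
  by apply: ccontM => //; exact: ccont_cst.
by move=> z z1; rewrite mulrC ler_wpM2r ?k0 // poisson_kernel_ub.
Qed.

Lemma mean_le_poisson k : ccont k -> (forall z, normc z = 1 -> 0 <= k z) ->
  (1 - normc w) / 2 * rmean k <= poisson k w.
Proof.
move=> ck k0; rewrite -rmeanZ //; apply: le_rmean; last 2 first.
- exact: ccont_poisson.
- by move=> z z1; rewrite [leRHS]mulrC ler_wpM2r ?k0 // poisson_kernel_lb.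
by apply: ccontM => //; exact: ccont_cst.
Qed.

(* Jensen's inequality: integrate the tangent line of [expR] at the barycentre. *)
Lemma poisson_expR k : ccont k -> expR (poisson k w) <= poisson (fun z => expR (k z)) w.
Proof.
move=> ck; set a := poisson k w.
have ce : ccont (fun z => expR (k z)).
  by apply: ccont_comp ck => t; exact: continuous_expR.
have c1 : ccont (fun z => expR a * k z) by apply: ccontM => //; exact: ccont_cst.
have cl : ccont (fun z => expR a * (1 - a) + expR a * k z).
  by apply: ccontD => //; exact: ccont_cst.
have -> : expR a = poisson (fun z => expR a * (1 - a) + expR a * k z) w.
  rewrite poissonD ?poisson_cst ?poissonZ //; last exact: ccont_cst.
  by rewrite -/a -mulrDr subrK mulr1.
apply: (le_poisson cl ce) => z _; rewrite -mulrDr.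
rewrite -[in leRHS](subrK a (k z)) [k z - a + a]addrC expRD.
rewrite ler_pM2l ?expR_gt0 //; have := expR_ge1Dx (k z - a); lra.
Qed.

End poisson_algebra.

Lemma circle_dist_sqr z z0 : normc z = 1 -> normc z0 = 1 ->
  normc (z - z0) ^+ 2 = 2 - 2 * Re (conjc z0 * z).
Proof.
move=> z1 z01; have := normc_sqr z; have := normc_sqr z0.
rewrite z1 z01 expr1n normc_sqr.
case: z z0 {z1 z01} => [a b] [c d] /= h1 h2.
transitivity ((a ^+ 2 + b ^+ 2) + (c ^+ 2 + d ^+ 2) - 2 * (c * a + d * b)); first ring.
by rewrite -h1 -h2; ring.
Qed.

Definition poisson_ext k z := if normc z < 1 then poisson k z else k z.

(* Korovkin's argument: [|k z - k z0| <= e / 4 + C |z - z0|^2] on the circle, where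
   [|z - z0|^2] is an affine function of [z], whose Poisson integral is explicit. *)
Lemma poisson_boundary k z0 (M : R) : {within @circle R, continuous (k : R[i]^o -> R)} ->
  (forall z, normc z = 1 -> `|k z| <= M) -> normc z0 = 1 ->
  forall e, 0 < e -> exists2 d : R, 0 < d &
    forall w, disc w -> normc (w - z0) < d -> `|poisson k w - k z0| < e.
Proof.
move=> wk kM z01 e e0; have ck := within_circle_ccont wk.
have M0 : 0 <= M := le_trans (normr_ge0 _) (kM z0 z01).
have e4 : 0 < e / 4 by rewrite divr_gt0.
move/within_normcP : wk => /(_ z0 z01 _ e4)[d d0 kd].
(* For [|z - z0| >= d] the trivial bound [2 * M] on the oscillation is at most [C * |z - z0|^2]. *)
pose C := 2 * M / d ^+ 2; have C0 : 0 <= C by rewrite divr_ge0 ?mulr_ge0 ?exprn_ge0 // ltW.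
have kC z : normc z = 1 -> `|k z - k z0| <= e / 4 + C * normc (z - z0) ^+ 2.
  move=> z1; have [zd|zd] := ltP (normc (z - z0)) d.
    by rewrite -[leLHS]addr0 lerD ?(ltW (kd _ _ _)) // mulr_ge0 ?sqr_ge0.
  apply: (@le_trans _ _ (2 * M)).
    by apply: le_trans (ler_normB _ _) _; have := kM z z1; have := kM z0 z01; lra.
  rewrite -[leLHS]add0r lerD ?(ltW e4) // /C -mulrA ler_peMr ?mulr_ge0 //.
  rewrite mulrC ler_pdivlMr ?exprn_gt0 // mul1r lerXn2r ?nnegrE ?normc_ge0 //.
  exact: ltW.
have zz z : normc z = 1 -> normc (z - z0) ^+ 2 = 2 - 2 * Re (conjc z0 * z).
  by move=> z1; exact: circle_dist_sqr.
pose g z := (e / 4 + 2 * C) + - (2 * C) * Re (conjc z0 * z).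
have cl := @ccont_Re_linear R (conjc z0).
have cl' (c : R) : ccont (fun z => c * Re (conjc z0 * z)) by apply: ccontM => //; exact: ccont_cst.
have cg : ccont g by apply: ccontD => //; exact: ccont_cst.
have kg z : normc z = 1 -> `|k z - k z0| <= g z.
  by move=> z1; apply: le_trans (kC z z1) _; rewrite zz // /g; lra.
pose e' := e / (4 * (2 * C + 1)).
have C1 : 0 < 2 * C + 1 by rewrite ltr_wpDl // mulr_ge0.
exists e'; first by rewrite divr_gt0 // mulr_gt0.
move=> w w1 we.
have Pg : poisson g w = (e / 4 + 2 * C) - 2 * C * Re (conjc z0 * w).
  by rewrite poissonD ?poissonZ ?poisson_cst ?poisson_Re_linear ?mulNr //; exact: ccont_cst.
have gw : poisson g w <= e / 2.
  have zc : Re (conjc z0 * z0) = 1.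
    have := normc_sqr z0; rewrite z01 expr1n; case: (z0) => a b /= ->; ring.
  have h : 1 - Re (conjc z0 * w) <= normc (w - z0).
    rewrite -zc -cReN -cReD -mulrBr; apply: le_trans (ler_norm _) _.
    by apply: le_trans (normRe _) _; rewrite normcM normc_conj z01 mul1r normc_distC.
  have h2 : 2 * C * normc (w - z0) <= e / 4.
    apply: (@le_trans _ _ ((2 * C + 1) * e')).
      apply: ler_pM; [exact: mulr_ge0|exact: normc_ge0| |exact: ltW].
      by rewrite lerDl ler01.
    by rewrite le_eqVlt; apply/orP; left; apply/eqP; rewrite /e'; field; rewrite gt_eqF.
  have h3 : 2 * C * (1 - Re (conjc z0 * w)) <= 2 * C * normc (w - z0).
    by rewrite ler_wpM2l // mulr_ge0.
  rewrite Pg; lra.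
apply: (@le_lt_trans _ _ (e / 2)); last lra.
have ckc : ccont (fun z => k z - k z0) by apply: ccontB => //; exact: ccont_cst.
have Pk : poisson (fun z => k z - k z0) w = poisson k w - k z0.
  by rewrite (poissonD w1 ck (@ccont_cst R _)) poisson_cst.
have cNg : ccont (fun z => -1 * g z) by apply: ccontM => //; exact: ccont_cst.
rewrite -Pk ler_norml; apply/andP; split.
  have : poisson (fun z => -1 * g z) w <= poisson (fun z => k z - k z0) w.
    apply: le_poisson => // z /kg; rewrite ler_norml; lra.
  rewrite poissonZ //; lra.
apply: le_trans gw; apply: le_poisson => // z /kg; rewrite ler_norml; lra.
Qed.

Lemma poisson_ext_continuous k : {within @circle R, continuous (k : R[i]^o -> R)} ->
  {within @cdisc R, continuous (poisson_ext k : R[i]^o -> R)}.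
Proof.
move=> wk; have ck := within_circle_ccont wk.
have [M M0 kM] := circle_bounded wk.
apply/within_normcP => z z1 e e0; rewrite /poisson_ext.
case: ifPn => zd.
  have dS w : disc w -> derivable (schwarz k : R[i]^o -> R[i]^o) w 1.
    by move=> ?; exact: derivable_schwarz.
  have /within_normcP/(_ z zd e e0)[d d0 H] := within_derivable (@lip_Re R) dS.
  exists (Num.min d (1 - normc z)); first by rewrite lt_min d0 subr_gt0.
  move=> w _; rewrite lt_min => /andP[wd wz].
  have w1 : normc w < 1.
    by have := lerB_normc w z; lra.
  by rewrite w1; exact: H.
have {}z1 : normc z = 1 by apply/eqP; rewrite eq_le z1 leNgt.
have [d1 d10 H1] := poisson_boundary wk kM z1 e0.
move/within_normcP : wk => /(_ z z1 e e0)[d2 d20 H2].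
exists (Num.min d1 d2); first by rewrite lt_min d10.
move=> w w1; rewrite lt_min => /andP[h1 h2]; case: ifPn => wd; first exact: H1.
by apply: H2 => //; apply/eqP; rewrite eq_le w1 leNgt.
Qed.

End poisson2.

(** * Subharmonicity of |F|^p *)

Section subharmonic.
Variable R : realType.
Local Notation Re := (@complex.Re R).
Local Notation Im := (@complex.Im R).
Implicit Types (k v V : R[i] -> R) (F : R[i] -> R[i]) (w z : R[i]) (p : R).

Lemma continuous_powR_norm p : 0 < p -> continuous (fun x : R => `|x| `^ p).
Proof.
move=> p0 x; have [->|x0] := eqVneq x 0.
  apply/cvgrPdist_lt => e e0; have ep : 0 < e `^ p^-1 by rewrite powR_gt0.
  near=> y; have : `|y - 0| < e `^ p^-1 by near: y; exact: near_dist_lt.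
  rewrite subr0 normr0 powR0 ?gt_eqF // sub0r normrN (ger0_norm (powR_ge0 _ _)) => ye.
  have -> : e = (e `^ p^-1) `^ p by rewrite -powRrM mulVf ?gt_eqF // powRr1 // ltW.
  by apply: gt0_ltr_powR => //; rewrite nnegrE // ltW.
apply: (@continuous_comp _ _ _ (fun x : R => `|x|) (fun x => x `^ p)).
  exact: norm_continuous.
apply: differentiable_continuous; apply/derivable1_diffP/derivable_powR.
by rewrite in_itv /= andbT normr_gt0.
Unshelve. all: by end_near. Qed.

Lemma continuous_ln_max (e : R) : 0 < e -> continuous (fun x : R => ln (Num.max x e)).
Proof.
move=> e0 x; apply: (@continuous_comp _ _ _ (fun x : R => Num.max x e) (@ln R)).
  by apply: (@continuous_max _ _ id (fun=> e)); [exact: cvg_id|exact: cst_continuous].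
by apply: continuous_ln; rewrite lt_max e0 orbT.
Qed.

Lemma within_normc_derivable (A : set R[i]^o) F (f : R -> R) : continuous f ->
  (forall z, A z -> derivable (F : R[i]^o -> R[i]^o) z 1) ->
  {within A, continuous ((fun z => f (normc (F z))) : R[i]^o -> R)}.
Proof.
move=> cf dF; apply: (within_comp cf (v := fun z => normc (F z))).
exact: within_derivable (@ler_dist_normc R) dF.
Qed.

Lemma within_normc_powR (A : set R[i]^o) F p : 0 < p ->
  (forall z, A z -> derivable (F : R[i]^o -> R[i]^o) z 1) ->
  {within A, continuous ((fun z => normc (F z) `^ p) : R[i]^o -> R)}.
Proof.
move=> p0 dF; have := within_normc_derivable (continuous_powR_norm p0) dF.
suff -> : (fun z => `|normc (F z)| `^ p) = (fun z => normc (F z) `^ p) by [].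
by apply/funext => z; rewrite ger0_norm ?normc_ge0.
Qed.

Lemma disc_near z w : normc (w - z) < 1 - normc z -> disc w.
Proof.
move=> wz; rewrite /disc /=; have := lerB_normc w z.
by lra.
Qed.

Lemma disc_near_circle z w (s : R) : 0 <= s < 1 - normc z -> normc w = 1 ->
  disc (z + s%:C * w).
Proof.
move=> /andP[s0 sz] w1; rewrite /disc /=; apply: le_lt_trans (le_normcD _ _) _.
by rewrite normcM w1 normcR ger0_norm //; lra.
Qed.

Lemma poisson_mean_local k z (s : R) : ccont k -> disc z -> 0 <= s < 1 - normc z ->
  ccont (fun w => poisson k (z + s%:C * w)) /\
  rmean (fun w => poisson k (z + s%:C * w)) = poisson k z.
Proof.
move=> ck z1 sz; have d0 : 0 < 1 - normc z by rewrite subr_gt0.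
have dS w : normc (w - z) < 1 - normc z ->
    derivable (schwarz k : R[i]^o -> R[i]^o) w 1.
  by move=> wz; apply: derivable_schwarz => //; exact: (disc_near wz).
split; first exact: (ccont_local d0 dS (@lip_Re R) sz).
exact: (mean_value_local d0 dS sz).
Qed.

(* The outer function [cexp (schwarz k)], with [k = ln (max |F| e)] on the circle,
   dominates [F] there; it does not vanish, so the maximum principle for the
   quotient propagates the bound inside without factoring out the zeros of [F]. *)
Lemma normc_le_outer F (d e : R) w : 1 < d -> 0 < e ->
  (forall z, normc z < d -> derivable (F : R[i]^o -> R[i]^o) z 1) -> disc w ->
  normc (F w) <= expR (poisson (fun z => ln (Num.max (normc (F z)) e)) w).
Proof.
move=> d1 e0 dF w1; set k := fun z => ln (Num.max (normc (F z)) e).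
have dFc z : cdisc z -> derivable (F : R[i]^o -> R[i]^o) z 1.
  by move=> z1; apply: dF; exact: le_lt_trans z1 d1.
have wk : {within @circle R, continuous (k : R[i]^o -> R)}.
  apply: (within_normc_derivable (continuous_ln_max e0)) => z z1.
  by apply: dFc; rewrite /cdisc /= z1.
have ck := within_circle_ccont wk.
(* On the circle [v] is [|F| / max(|F|, e) <= 1]; inside it is the modulus of the holomorphic [G]
   below. The cut-off [e] keeps the logarithm continuous where [F] vanishes. *)
pose v z := normc (F z) * expR (- poisson_ext k z).
have cv : {within @cdisc R, continuous (v : R[i]^o -> R)}.
  apply: withinM; first exact: within_derivable (@ler_dist_normc R) dFc.
  apply: (within_comp (f := fun x => expR (- x))); last exact: poisson_ext_continuous.
  move=> x; apply: (@continuous_comp _ _ _ (fun x : R => - x) (@expR R)).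
    exact: (@continuousN R R^o _ id x (@cvg_id _ _)).
  exact: continuous_expR.
pose G z := F z * cexp (- schwarz k z).
have vG z : disc z -> v z = normc (G z).
  move=> z1; rewrite /v /G normcM normc_cexp cReN Re_schwarz /poisson_ext.
  by rewrite (z1 : is_true (_ < 1)).
have dG z : disc z -> derivable (G : R[i]^o -> R[i]^o) z 1.
  move=> z1; apply: cderivableM; first by apply: dFc; exact: disc_cdisc.
  apply: (@derivable_comp1 _ (@cexp R)); last exact: derivable_cexp.
  by apply: derivableN; exact: derivable_schwarz.
have sv z : disc z -> submean v z.
  move=> z1; have z0 : 0 < 1 - normc z by rewrite subr_gt0.
  exists (1 - normc z) => // s /andP[s0 sz].
  have sz' : 0 <= s < 1 - normc z by rewrite ltW.
  have := norm_mean_local z0 (fun u uz => dG u (disc_near uz)) sz'.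
  rewrite vG // => /le_trans; apply; rewrite le_eqVlt; apply/orP; left; apply/eqP.
  by apply: eq_rmean => u u1; rewrite vG //; exact: disc_near_circle.
have : v w <= 1.
  apply: (max_principle cv sv) (disc_cdisc w1) => z z1.
  rewrite /v /poisson_ext z1 ltxx expRN /k lnK ?posrE ?lt_max ?e0 ?orbT //.
  by rewrite ler_pdivrMr ?lt_max ?e0 ?orbT // mul1r le_max lexx.
by rewrite /v /poisson_ext (w1 : is_true (_ < 1)) expRN ler_pdivrMr ?expR_gt0 // mul1r.
Qed.

Lemma normc_powR_le_poisson F (d p : R) w : 1 < d -> 0 < p ->
  (forall z, normc z < d -> derivable (F : R[i]^o -> R[i]^o) z 1) -> disc w ->
  normc (F w) `^ p <= poisson (fun z => normc (F z) `^ p) w.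
Proof.
move=> d1 p0 dF w1; apply/ler_addgt0Pr => t t0.
pose e := t `^ p^-1; have e0 : 0 < e by rewrite powR_gt0.
have ep : e `^ p = t by rewrite -powRrM mulVf ?gt_eqF // powRr1 // ltW.
have dFc z : circle z -> derivable (F : R[i]^o -> R[i]^o) z 1.
  by move=> z1; apply: dF; rewrite z1.
have cF := within_circle_ccont (within_normc_powR p0 dFc).
have m0 z : 0 < Num.max (normc (F z)) e by rewrite lt_max e0 orbT.
set k := fun z => ln (Num.max (normc (F z)) e).
have ck : ccont k.
  exact: (within_circle_ccont (within_normc_derivable (continuous_ln_max e0) dFc)).
have cpk : ccont (fun z => p * k z) by apply: ccontM => //; exact: ccont_cst.
apply: (@le_trans _ _ (expR (poisson (fun z => p * k z) w))).
  rewrite poissonZ // mulrC expRM; apply: ge0_ler_powR; rewrite ?nnegrE ?normc_ge0 ?expR_ge0 //.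
    exact: ltW.
  exact: normc_le_outer d1 e0 dF w1.
apply: le_trans (poisson_expR w1 cpk) _.
rewrite -(poisson_cst w1 t) -poissonD //; last exact: ccont_cst.
apply: le_poisson => //.
- by apply: ccont_comp cpk => x; exact: continuous_expR.
- by apply: ccontD => //; exact: ccont_cst.
move=> z _; rewrite /k -ln_powR lnK ?posrE ?powR_gt0 //.
have [h|h] := leP (normc (F z)) e; rewrite ?ep ?lerDr ?powR_ge0 // lerDl ltW //.
Qed.

Lemma withinN (A : set R[i]^o) v : {within A, continuous (v : R[i]^o -> R)} ->
  {within A, continuous ((fun z => - v z) : R[i]^o -> R)}.
Proof.
move=> cv; apply: (within_comp (f := fun x => - x)) cv.
by move=> x; exact: (@continuousN R R^o _ id x (@cvg_id _ _)).
Qed.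

(** The difference of [V] and its Poisson extension vanishes on the circle and inherits the sub-mean
    property, the Poisson integral having exact local means. *)
Lemma submean_le_poisson V w : {within @cdisc R, continuous (V : R[i]^o -> R)} ->
  (forall z, disc z -> submean V z) -> disc w -> V w <= poisson V w.
Proof.
move=> cV sV w1.
have wV : {within @circle R, continuous (V : R[i]^o -> R)}.
  exact: within_subset (@circle_cdisc R) cV.
have ck := within_circle_ccont wV.
pose u z := V z + - poisson_ext V z.
have cu : {within @cdisc R, continuous (u : R[i]^o -> R)}.
  by apply: withinD => //; apply: withinN; exact: poisson_ext_continuous.
have pE z : disc z -> poisson_ext V z = poisson V z.
  by move=> z1; rewrite /poisson_ext (z1 : is_true (_ < 1)).
have su z : disc z -> submean u z.
  move=> z1; have [d d0 H] := sV z z1.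
  have z0 : 0 < 1 - normc z by rewrite subr_gt0.
  exists (Num.min d (1 - normc z)); first by rewrite lt_min d0.
  move=> s; rewrite lt_min => /and3P[s0 sd sz].
  have sz' : 0 <= s < 1 - normc z by rewrite ltW.
  have [cP mP] := poisson_mean_local ck z1 sz'.
  have cVz : ccont (fun w => V (z + s%:C * w)).
    by apply: (ccont_within cV) => y y1; apply: disc_cdisc; exact: disc_near_circle.
  rewrite (@eq_rmean _ _ (fun w => V (z + s%:C * w) - poisson V (z + s%:C * w))).
    by rewrite rmeanB // mP /u pE // lerD2r; apply: H; rewrite s0.
  by move=> y y1; rewrite /u pE //; exact: disc_near_circle.
have : u w <= 0.
  apply: (max_principle cu su) (disc_cdisc w1) => z z1.
  by rewrite /u /poisson_ext z1 ltxx subrr.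
by rewrite /u pE // subr_le0.
Qed.

Lemma disc0 : disc (0 : R[i]). Proof. by rewrite /disc /mkset normc0. Qed.

Lemma poisson0 k : poisson k 0 = rmean k.
Proof.
apply: eq_rmean => z z1; rewrite (poisson_kernelE disc0 z1) normc0 subr0 z1.
by rewrite expr0n /= subr0 expr1n divr1 mulr1.
Qed.

Lemma submean_mean V : {within @cdisc R, continuous (V : R[i]^o -> R)} ->
  (forall z, disc z -> submean V z) -> V 0 <= rmean V.
Proof. by move=> cV sV; rewrite -poisson0 submean_le_poisson //; exact: disc0. Qed.

End subharmonic.

(** * Locally uniform limits *)

Section limits.
Variable R : realType.
Local Notation Re := (@complex.Re R).
Local Notation Im := (@complex.Im R).
Implicit Types (k v V : R[i] -> R) (F f : R[i] -> R[i]) (w z : R[i]) (p : R).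

Lemma Re_le_poisson F (d : R) w : 1 < d ->
  (forall z, normc z < d -> derivable (F : R[i]^o -> R[i]^o) z 1) -> disc w ->
  Re (F w) <= poisson (fun z => Re (F z)) w.
Proof.
move=> d1 dF w1; have dFc z : cdisc z -> derivable (F : R[i]^o -> R[i]^o) z 1.
  by move=> z1; apply: dF; exact: le_lt_trans z1 d1.
apply: (@submean_le_poisson _ (fun z => Re (F z)) w) => //.
  exact: within_derivable (@lip_Re R) dFc.
move=> z z1; have z0 : 0 < 1 - normc z by rewrite subr_gt0.
exists (1 - normc z) => // s /andP[s0 sz].
have sz' : 0 <= s < 1 - normc z by rewrite ltW.
rewrite (mean_value_local z0 _ sz') // => u uz; apply: dFc; apply: disc_cdisc.
exact: (disc_near uz).
Qed.

Lemma Re_poisson F (d : R) w : 1 < d ->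
  (forall z, normc z < d -> derivable (F : R[i]^o -> R[i]^o) z 1) -> disc w ->
  Re (F w) = poisson (fun z => Re (F z)) w.
Proof.
move=> d1 dF w1; apply/eqP; rewrite eq_le (Re_le_poisson d1 dF w1) /=.
have dN z : normc z < d -> derivable ((fun z => - F z) : R[i]^o -> R[i]^o) z 1.
  by move=> zd; apply: derivableN; exact: dF.
have cF : ccont (fun z => Re (F z)).
  by apply: (ccont_derivable (@lip_Re R)) => z z1; apply: dF; rewrite z1.
have := Re_le_poisson d1 dN w1.
have -> : poisson (fun z => Re (- F z)) w = poisson (fun z => -1 * Re (F z)) w.
  by congr poisson; apply/funext => z; rewrite cReN mulN1r.
by rewrite poissonZ // cReN mulN1r lerN2.
Qed.

(** On the circle [Re (F * conj_kernel w)] is [Re F] times the Poisson kernel plus [Im F * Im S],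
    with [S] the Schwarz kernel. The left side has mean [Re (F 0)] and the first term on the right
    has mean [Re (F w)]. *)
Lemma Re_schwarz_formula F (d : R) w : 1 < d ->
  (forall z, normc z < d -> derivable (F : R[i]^o -> R[i]^o) z 1) -> disc w ->
  rmean (fun z => Im (F z) * Im (schwarz_kernel w z)) = Re (F 0) - Re (F w).
Proof.
move=> d1 dF w1; have [_ <-] := mean_conj_kernel w1 d1 dF.
have dFc z : normc z = 1 -> derivable (F : R[i]^o -> R[i]^o) z 1.
  by move=> z1; apply: dF; rewrite z1.
have cR := ccont_derivable (@lip_Re R) dFc.
have cI := ccont_derivable (@lip_Im R) dFc.
have [kR kI] := ccont2_schwarz_kernel w1.
rewrite (Re_poisson d1 dF w1) /poisson.
rewrite (@eq_rmean _ (fun z => Re (F z * conj_kernel w z))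
  (fun z => Re (F z) * poisson_kernel w z + Im (F z) * Im (schwarz_kernel w z))).
  by rewrite rmeanD; [rewrite addrAC subrr add0r|exact: ccontM|exact: ccontM].
move=> z z1; rewrite /poisson_kernel schwarz_kernel_conj // cReM.
by case: (conj_kernel w z) => a b /=; rewrite mulrN.
Qed.

(* Reproduces a holomorphic function from its values on the unit circle, while being
   holomorphic for arbitrary continuous boundary values: this is how holomorphy
   passes to uniform limits. *)
Definition schwarz_rep f w : R[i] :=
  2^-1 * (schwarz (fun z => Re (f z)) w + 'i * schwarz (fun z => Im (f z)) w + f 0).

Lemma ReZ (a : R) z : Re (a%:C * z) = a * Re z.
Proof. by rewrite cReM /= mul0r subr0. Qed.

Lemma ImZ (a : R) z : Im (a%:C * z) = a * Im z.
Proof. by rewrite cImM /= mul0r addr0. Qed.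

Lemma Re_i z : Re ('i * z) = - Im z.
Proof. by rewrite cReM /= mul0r sub0r mul1r. Qed.

Lemma Im_i z : Im ('i * z) = Re z.
Proof. by rewrite cImM /= mul0r add0r mul1r. Qed.

Lemma half_complex : 2^-1 = (2^-1)%:C :> R[i].
Proof. by rewrite fmorphV rmorph_nat. Qed.

Lemma Re_schwarz_rep f w : Re (schwarz_rep f w) = 2^-1 * (poisson (fun z => Re (f z)) w -
  rmean (fun z => Im (f z) * Im (schwarz_kernel w z)) + Re (f 0)).
Proof. by rewrite /schwarz_rep half_complex ReZ !cReD Re_i. Qed.

Lemma Im_schwarz_rep f w : Im (schwarz_rep f w) = 2^-1 * (poisson (fun z => Im (f z)) w +
  rmean (fun z => Re (f z) * Im (schwarz_kernel w z)) + Im (f 0)).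
Proof. by rewrite /schwarz_rep half_complex ImZ !cImD Im_i [X in X + Im _]addrC. Qed.

(** The real part adds the Poisson formula to [Re_schwarz_formula]; the imaginary part is the same
    computation for [- 'i * F]. *)
Lemma schwarz_repE F (d : R) w : 1 < d ->
  (forall z, normc z < d -> derivable (F : R[i]^o -> R[i]^o) z 1) -> disc w ->
  schwarz_rep F w = F w.
Proof.
move=> d1 dF w1.
have dG z : normc z < d -> derivable ((fun z => - 'i * F z) : R[i]^o -> R[i]^o) z 1.
  by move=> zd; apply: cderivableMl; exact: dF.
have ReG x : Re (- 'i * x) = Im x by rewrite mulNr cReN Re_i opprK.
have ImG x : Im (- 'i * x) = - Re x by rewrite mulNr cImN Im_i.
have dFc z : normc z = 1 -> derivable (F : R[i]^o -> R[i]^o) z 1.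
  by move=> z1; apply: dF; rewrite z1.
have cR := ccont_derivable (@lip_Re R) dFc.
have [_ kI] := ccont2_schwarz_kernel w1.
apply: ReIm_eq.
  rewrite Re_schwarz_rep (Re_schwarz_formula d1 dF w1) -(Re_poisson d1 dF w1); lra.
rewrite Im_schwarz_rep.
have := Re_schwarz_formula d1 dG w1; rewrite !ReG.
have -> : rmean (fun z => Im (- 'i * F z) * Im (schwarz_kernel w z)) =
    - rmean (fun z => Re (F z) * Im (schwarz_kernel w z)).
  rewrite -[RHS]mulN1r -rmeanZ; last exact: ccontM.
  by apply: eq_rmean => z _; rewrite ImG mulN1r mulNr.
have := Re_poisson d1 dG w1; rewrite ReG.
have -> : (fun z => Re (- 'i * F z)) = (fun z => Im (F z)).
  by apply/funext => z; rewrite ReG.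
move=> <-; lra.
Qed.

Lemma schwarzB k1 k2 w : disc w -> ccont k1 -> ccont k2 ->
  schwarz (fun z => k1 z - k2 z) w = schwarz k1 w - schwarz k2 w.
Proof.
move=> w1 c1 c2; have [kR kI] := ccont2_schwarz_kernel w1.
apply: ReIm_eq; rewrite !ReImE /= -rmeanB; do ?exact: ccontM.
  by apply: eq_rmean => z _; rewrite mulrBl.
by apply: eq_rmean => z _; rewrite mulrBl.
Qed.

Lemma disc_div (s : R) z : 0 < s -> normc z < s -> disc (s%:C^-1 * z).
Proof.
by move=> s0 zs; rewrite /disc /= normcM normcV normcR gtr0_norm // mulrC ltr_pdivrMr // mul1r.
Qed.

Lemma derivable_scale f (s : R) z : analytic_on_disc f -> 0 < s < 1 -> normc z < s^-1 ->
  derivable ((fun z => f (s%:C * z)) : R[i]^o -> R[i]^o) z 1.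
Proof.
move=> af /andP[s0 s1] zs; apply: (@derivable_comp1 _ f).
  by apply: cderivableMl; exact: derivable_id.
apply: af; rewrite /disc /= normcM normcR gtr0_norm //.
by rewrite mulrC -ltr_pdivlMr // div1r.
Qed.

(** After rescaling by some [s] between [|z|] and 1, convergence is uniform on the closed unit disc.
    There [schwarz_rep] reproduces the approximants and is stable under uniform limits of its data,
    so it reproduces the limit and makes it holomorphic. *)
Lemma analytic_limit (f_ : nat -> R[i] -> R[i]) f :
  (forall n, analytic_on_disc (f_ n)) ->
  (forall r e : R, r < 1 -> 0 < e -> exists n, forall z, normc z <= r ->
     normc (f_ n z - f z) <= e) ->
  analytic_on_disc f.
Proof.
move=> af Hf z z1; have zlt : normc z < 1 by []; have zge := normc_ge0 z.
pose s := (1 + normc z) / 2.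
have s0 : 0 < s by rewrite /s; lra.
have s1 : s < 1 by rewrite /s; lra.
have zs : normc z < s by rewrite /s; lra.
have s01 : 0 < s < 1 by rewrite s0.
have is1 : 1 < s^-1 by rewrite invf_gt1.
pose g z := f (s%:C * z); pose g_ n z := f_ n (s%:C * z).
have dg n u : normc u < s^-1 -> derivable (g_ n : R[i]^o -> R[i]^o) u 1.
  exact: derivable_scale.
have Hg e : 0 < e -> exists n, forall u, cdisc u -> normc (g_ n u - g u) <= e.
  move=> e0; have [n H] := Hf s e s1 e0; exists n => u u1; apply: H.
  by rewrite normcM normcR gtr0_norm // -[leRHS]mulr1 ler_pM2l.
have cg v : (forall x y, `|v x - v y| <= normc (x - y)) -> ccont (fun u => v (g u)).
  move=> lv; apply: within_circle_ccont; apply/within_normcP => u u1 e e0.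
  have e3 : 0 < e / 4 by rewrite divr_gt0.
  have [n Hn] := Hg _ e3.
  have dgc x : circle x -> derivable (g_ n : R[i]^o -> R[i]^o) x 1.
    by move=> x1; apply: dg; rewrite x1.
  have /within_normcP/(_ u u1 _ e3)[d d0 Hd] := within_derivable lv dgc.
  exists d => // w w1 wd.
  have h1 := le_trans (lv _ _) (Hn w (circle_cdisc w1)).
  have h2 := le_trans (lv _ _) (Hn u (circle_cdisc u1)).
  have h3 := Hd w w1 wd; move: h1 h2 h3.
  rewrite !ler_norml !ltr_norml; lra.
have cgn n v : (forall x y, `|v x - v y| <= normc (x - y)) -> ccont (fun u => v (g_ n u)).
  by move=> lv; apply: (ccont_derivable lv) => x x1; apply: dg; rewrite x1.
have gE w : disc w -> g w = schwarz_rep g w.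
  move=> w1; apply/eqP; rewrite -subr_eq0 -normc_eq0 -[_ == 0]orFb.
  have r0 : 0 < 1 - normc w by rewrite subr_gt0.
  (* Halved, the two Schwarz integrals contribute [4 / (1 - normc w)] units of [e / C]; the values
     at [w] and at 0 contribute less than 2. *)
  pose C := 4 / (1 - normc w) + 2; have C0 : 0 < C by rewrite ltr_wpDl // divr_ge0 // ltW.
  rewrite orFb eq_le normc_ge0 andbT; apply/ler_addgt0Pr => e e0; rewrite add0r.
  have eC : 0 < e / C by rewrite divr_gt0.
  have [n Hn] := Hg _ eC.
  have -> : g w - schwarz_rep g w =
      - (g_ n w - g w) + (schwarz_rep (g_ n) w - schwarz_rep g w).
    by rewrite (schwarz_repE is1 (dg n) w1); ring.
  have w1' := disc_cdisc w1.
  apply: le_trans (le_normcD _ _) _; rewrite normcN.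
  have -> : schwarz_rep (g_ n) w - schwarz_rep g w =
      2^-1 * (schwarz (fun z => Re (g_ n z) - Re (g z)) w +
      'i * schwarz (fun z => Im (g_ n z) - Im (g z)) w + (g_ n 0 - g 0)).
    rewrite !schwarzB //; do ?[exact: cg (@lip_Re R)|exact: cg (@lip_Im R)|
      exact: cgn (@lip_Re R)|exact: cgn (@lip_Im R)].
    by rewrite /schwarz_rep; ring.
  have BR : normc (schwarz (fun z => Re (g_ n z) - Re (g z)) w) <= 4 / (1 - normc w) * (e / C).
    apply: schwarz_bound => //; first by apply: ccontB; [exact: cgn (@lip_Re R)|exact: cg (@lip_Re R)].
    move=> u u1; apply: le_trans (lip_Re _ _) (Hn u _); by rewrite /cdisc /= u1.
  have BI : normc (schwarz (fun z => Im (g_ n z) - Im (g z)) w) <= 4 / (1 - normc w) * (e / C).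
    apply: schwarz_bound => //; first by apply: ccontB; [exact: cgn (@lip_Im R)|exact: cg (@lip_Im R)].
    move=> u u1; apply: le_trans (lip_Im _ _) (Hn u _); by rewrite /cdisc /= u1.
  have B0 : normc (g_ n 0 - g 0) <= e / C by apply: Hn; apply: disc_cdisc; exact: disc0.
  rewrite normcM half_complex normcR ger0_norm //.
  have := le_normcD (schwarz (fun z => Re (g_ n z) - Re (g z)) w +
      'i * schwarz (fun z => Im (g_ n z) - Im (g z)) w) (g_ n 0 - g 0).
  have := le_normcD (schwarz (fun z => Re (g_ n z) - Re (g z)) w)
      ('i * schwarz (fun z => Im (g_ n z) - Im (g z)) w).
  rewrite normcM normc_i mul1r => h1 h2; have h3 := Hn w w1'.
  have -> : e = (4 / (1 - normc w)) * (e / C) + 2 * (e / C).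
    by rewrite -mulrDl -/C mulrC divfK // gt_eqF.
  lra.
have dR : derivable ((fun u => schwarz_rep g (s%:C^-1 * u)) : R[i]^o -> R[i]^o) z 1.
  apply: (@derivable_comp1 _ (schwarz_rep g)).
    by apply: cderivableMl; exact: derivable_id.
  have d1 : disc (s%:C^-1 * z) by exact: disc_div.
  apply: cderivableMl; apply: derivableD; last exact: derivable_cst.
  apply: derivableD; first by apply: derivable_schwarz => //; exact: cg (@lip_Re R).
  by apply: cderivableMl; apply: derivable_schwarz => //; exact: cg (@lip_Im R).
have sz : 0 < s - normc z by rewrite subr_gt0.
apply: derivable_eq_near sz _ dR => u uz.
have us : normc u < s by have := lerB_normc u z; lra.
rewrite -gE; last exact: disc_div.
rewrite /g mulVKf // (_ : 0 = 0%:C) // (inj_eq (@complexI R)) gt_eqF //.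
Qed.

End limits.

(** * Composition with a self-map of the disc *)

Section pmeans.
Variables (R : realType) (p : R).
Hypothesis p0 : 0 < p.
Local Notation mu := (@lebesgue_measure R).
Implicit Types (F f phi : R[i] -> R[i]) (w z : R[i]) (r s : R).

Definition pmean f r := rmean (fun z => normc (f (r%:C * z)) `^ p).

Lemma ccont_pmean f r : analytic_on_disc f -> 0 <= r < 1 ->
  ccont (fun z => normc (f (r%:C * z)) `^ p).
Proof.
move=> af r01; have cf := within_normc_powR p0 af.
have := @ccont_within _ _ _ 0 r%:C cf => K.
by apply: eq_ccont (K _) => z z1; rewrite add0r //; exact: disc_scale.
Qed.

Lemma circle_meanE f r : analytic_on_disc f -> 0 <= r < 1 ->
  circle_mean p f r = (pmean f r)%:E.
Proof.
move=> af r01; rewrite /circle_mean /pmean /rmean /Rintegral EFinM fineK //.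
by apply: integrable_fin_num => //; exact: (ccont_integrable (ccont_pmean af r01)).
Qed.

Lemma pmean_ge0 f r : 0 <= pmean f r.
Proof. by apply: rmean_ge0 => z _; exact: powR_ge0. Qed.

Lemma pmean_le_hardy f r : analytic_on_disc f -> 0 <= r < 1 ->
  ((pmean f r)%:E <= hardy_normp p f)%E.
Proof.
move=> af r01; rewrite -circle_meanE //; apply: ereal_sup_ubound.
by exists r => //=; rewrite in_itv.
Qed.

Lemma hardy_le f (C : R) : analytic_on_disc f ->
  (forall r, 0 <= r < 1 -> pmean f r <= C) -> (hardy_normp p f <= C%:E)%E.
Proof.
move=> af H; apply: ge_ereal_sup => _ [r r01 <-].
have {}r01 : 0 <= r < 1 by move: r01; rewrite /= in_itv.
by rewrite circle_meanE // lee_fin H.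
Qed.

Lemma powR_le_reg (x y : R) : 0 <= y -> x `^ p <= y `^ p -> x <= y.
Proof.
move=> y0 xy; rewrite leNgt; apply/negP => yx; move: xy; rewrite leNgt => /negP; apply.
by apply: gt0_ltr_powR => //; rewrite nnegrE // (le_trans y0 (ltW yx)).
Qed.

Lemma ccont_scaled f s : analytic_on_disc f -> 0 < s < 1 ->
  ccont (fun z => normc (f (s%:C * z)) `^ p).
Proof. by move=> af /andP[s0 s1]; apply: ccont_pmean => //; rewrite ltW. Qed.

Lemma powR_le_scaled_poisson f s w : analytic_on_disc f -> 0 < s < 1 -> normc w < s ->
  normc (f w) `^ p <= poisson (fun z => normc (f (s%:C * z)) `^ p) (s%:C^-1 * w).
Proof.
move=> af s01 ws; have /andP[s0 s1] := s01.
have is1 : 1 < s^-1 by rewrite invf_gt1.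
have sC : s%:C != 0 by rewrite -normc_eq0 normcR gtr0_norm // gt_eqF.
have dF z : normc z < s^-1 -> derivable ((fun z => f (s%:C * z)) : R[i]^o -> R[i]^o) z 1.
  exact: derivable_scale.
by have := normc_powR_le_poisson is1 p0 dF (disc_div s0 ws); rewrite mulVKf.
Qed.

Lemma normc_divs s w : 0 < s -> normc (s%:C^-1 * w) = normc w / s.
Proof. by move=> s0; rewrite normcM normcV normcR gtr0_norm // mulrC. Qed.

(** Controls a value by a single circle mean; this is what turns convergence in H^p into locally
    uniform convergence. *)
Lemma pointwise_bound f s w : analytic_on_disc f -> 0 < s < 1 -> normc w < s ->
  normc (f w) `^ p <= 2 / (1 - normc w / s) * pmean f s.
Proof.
move=> af s01 ws; apply: le_trans (powR_le_scaled_poisson af s01 ws) _.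
have /andP[s0 s1] := s01; rewrite -normc_divs //.
apply: (poisson_le_mean (disc_div s0 ws) (ccont_scaled af s01)) => z _.
exact: powR_ge0.
Qed.

Section selfmap.
Variable phi : R[i] -> R[i].
Hypothesis aphi : analytic_on_disc phi.
Hypothesis dphi : forall z, disc z -> disc (phi z).

Lemma analytic_compose f : analytic_on_disc f -> analytic_on_disc (fun z => f (phi z)).
Proof. by move=> af z z1; apply: (@derivable_comp1 _ f); [exact: aphi|exact/af/dphi]. Qed.

Lemma selfmap_compact r : 0 <= r < 1 ->
  exists2 s, s < 1 & forall z, normc z <= 1 -> normc (phi (r%:C * z)) <= s.
Proof.
move=> /andP[r0 r1].
have rd z : cdisc z -> disc (r%:C * z).
  move=> z1; rewrite /disc /= normcM normcR ger0_norm //.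
  by apply: le_lt_trans r1; rewrite -[leRHS]mulr1 ler_wpM2l.
have da z : cdisc z -> derivable ((fun z => phi (r%:C * z)) : R[i]^o -> R[i]^o) z 1.
  move=> z1; apply: (@derivable_comp1 _ phi); last exact/aphi/rd.
  by apply: cderivableMl; exact: derivable_id.
have [z z1 H] := cdisc_max (within_derivable (@ler_dist_normc R) da).
by exists (normc (phi (r%:C * z))) => [|w w1]; [exact/dphi/rd|exact: H].
Qed.

(** On the circle of radius [r], [|f o phi|^p] is dominated by the real part of a holomorphic
    function, the Schwarz integral of [K] at [phi / s]. Its mean is the value at the centre, a
    Poisson integral at [phi 0 / s]. *)
Lemma subordination f r : analytic_on_disc f -> 0 <= r < 1 ->
  exists2 s0, s0 < 1 & forall s, s0 < s < 1 -> 0 < s ->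
    pmean (fun z => f (phi z)) r <= 2 / (1 - normc (phi 0) / s) * pmean f s.
Proof.
(* On [|z| <= r'] the map [phi] stays in a disc of radius below [s], so after scaling by [r'] the
   majorant [G] is analytic on the whole unit disc, while the circle of radius [r] stays
   interior. *)
move=> af /andP[r0 r1]; pose r' := (1 + r) / 2.
have r'0 : 0 < r' by rewrite /r'; lra.
have r'1 : r' < 1 by rewrite /r'; lra.
have r'01 : 0 <= r' < 1 by rewrite ltW.
have r'0' := ltW r'0.
have rr' : 0 <= r / r' < 1.
  by rewrite divr_ge0 //= ltr_pdivrMr // mul1r /r'; lra.
have [s0 s01 H] := selfmap_compact r'01; exists s0 => // s /andP[s0s s1] sp.
have s_01 : 0 < s < 1 by rewrite sp.
pose K z := normc (f (s%:C * z)) `^ p.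
have cK : ccont K by exact: ccont_scaled.
pose G z := schwarz K (s%:C^-1 * phi (r'%:C * z)).
have dl (c : R[i]) z : derivable ((fun z => c * z) : R[i]^o -> R[i]^o) z 1.
  by apply: cderivableMl; exact: derivable_id.
have Hd z : disc z -> disc (r'%:C * z).
  move=> z1; rewrite /disc /= normcM normcR gtr0_norm //.
  by apply: lt_trans r'1; rewrite -[ltRHS]mulr1 ltr_pM2l.
have aG : analytic_on_disc G.
  move=> z z1; have pz : normc (phi (r'%:C * z)) < s.
    by apply: le_lt_trans s0s; apply: H; exact: ltW.
  apply: (@derivable_comp1 _ (schwarz K)); last first.
    by apply: derivable_schwarz => //; exact: disc_div.
  apply: (@derivable_comp1 _ (fun z => s%:C^-1 * z)); last exact: dl.
  apply: (@derivable_comp1 _ phi); [exact: dl|exact/aphi/Hd].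
have rE z : r'%:C * ((r / r')%:C * z) = r%:C * z.
  by rewrite mulrA -complexRM mulrC mulrC mulrCA mulfV ?mulr1 // gt_eqF.
have := mean_value aG rr'; rewrite {2}/G mulr0 Re_schwarz => HG.
have p0s : normc (phi 0) < s.
  by have := H 0; rewrite mulr0 normc0 ler01 => /(_ isT) h; exact: le_lt_trans h s0s.
rewrite -normc_divs //.
apply: le_trans (_ : poisson K (s%:C^-1 * phi 0) <= _); last first.
  apply: (poisson_le_mean (disc_div sp p0s) cK) => z _; exact: powR_ge0.
rewrite -HG; apply: le_rmean.
- have r01 : 0 <= r < 1 by rewrite r0.
  exact: (ccont_pmean (analytic_compose af) r01).
- exact: (ccont_disc0 (@lip_Re R) aG rr').
move=> z z1; rewrite /G Re_schwarz rE; apply: powR_le_scaled_poisson => //.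
rewrite -rE; apply: le_lt_trans s0s; apply: H.
by rewrite normcM z1 mulr1 normcR ger0_norm; case/andP : rr' => // _ /ltW.
Qed.

Lemma compose_hardy_fin f : analytic_on_disc f -> (hardy_normp p f < +oo)%E ->
  (hardy_normp p (fun z => f (phi z)) < +oo)%E.
Proof.
move=> af fin; have r00 : 0 <= (0 : R) < 1 by rewrite lexx ltr01.
have /fineK E : hardy_normp p f \is a fin_num.
  rewrite ge0_fin_numE //; apply: le_trans (pmean_le_hardy af r00).
  by rewrite lee_fin pmean_ge0.
have a1 : normc (phi 0) < 1 by apply: dphi; exact: disc0.
have a0 := normc_ge0 (phi 0).
(* The admissible [s] depend on [r], but the constant must not. For [s >= s1] the factor
   [2 / (1 - |phi 0| / s)] is at most its value at [s1]. *)
pose s1 := (1 + normc (phi 0)) / 2.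
have s1a : normc (phi 0) < s1 by rewrite /s1; lra.
have s11 : s1 < 1 by rewrite /s1; lra.
have s10 : 0 < s1 by rewrite /s1; lra.
pose C := 2 / (1 - normc (phi 0) / s1) * fine (hardy_normp p f).
apply: (@le_lt_trans _ _ C%:E); last exact: ltey.
apply: hardy_le; first exact: analytic_compose.
move=> r r01; have [s0 s01 H] := subordination af r01.
pose s := (1 + Num.max s0 s1) / 2.
have m1 : Num.max s0 s1 < 1 by rewrite gt_max s01.
have [m0 ms1] : s0 <= Num.max s0 s1 /\ s1 <= Num.max s0 s1 by rewrite !le_max !lexx orbT.
have ss : s0 < s < 1 by rewrite /s; lra.
have sp : 0 < s by rewrite /s; lra.
have s1s : s1 <= s by rewrite /s; lra.
apply: le_trans (H s ss sp) _; rewrite /C; apply: ler_pM.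
- by rewrite divr_ge0 // subr_ge0 ler_pdivrMr // mul1r; lra.
- exact: pmean_ge0.
- rewrite ler_pM2l // lef_pV2 ?posrE ?subr_gt0 ?ltr_pdivrMr ?mul1r //; last by lra.
  by rewrite lerD2l lerN2 ler_wpM2l // lef_pV2 ?posrE.
- rewrite -lee_fin E; apply: pmean_le_hardy => //; rewrite ltW //; by case/andP : ss.
Qed.

End selfmap.
End pmeans.

(** * The lower bound for composition with an inner function *)

Section lower_bound.
Variables (R : realType) (p : R).
Hypothesis p0 : 0 < p.
Local Notation mu := (@lebesgue_measure R).
Local Notation Re := (@complex.Re R).
Implicit Types (F : R[i] -> R[i]) (v : R[i] -> R) (w z : R[i]) (r : R).

Lemma within_compC (A B : set R[i]^o) v F : {within B, continuous (v : R[i]^o -> R)} ->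
  (forall z, A z -> B (F z)) ->
  (forall z, A z -> derivable (F : R[i]^o -> R[i]^o) z 1) ->
  {within A, continuous ((fun z => v (F z)) : R[i]^o -> R)}.
Proof.
move=> /within_normcP cv AB dF; apply/within_normcP => z Az e e0.
have [d d0 H] := cv _ (AB _ Az) e e0.
have /derivable_continuous/cvgrPdist_lt := dF z Az.
have d0' : 0 < d%:C :> R[i] by rewrite ltcR.
move=> /(_ _ d0')/nbhs_normcP[d' d'0 H']; exists d' => // w Aw wz.
apply: H; first exact: AB.
by have := H' w wz; rewrite normc_numE ltcR normc_distC.
Qed.

Section glue.
Variables (f : R[i] -> R[i]) (s : R).
Hypothesis af : analytic_on_disc f.
Hypothesis s01 : 0 < s < 1.

Let K z := normc (f (s%:C * z)) `^ p.

(* Subharmonic majorant of [|f|^p]: its Poisson integral inside the circle of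
   radius [s], itself outside. *)
Definition glued w := if normc w < s then poisson K (s%:C^-1 * w) else normc (f w) `^ p.

Let s0 : 0 < s. Proof. by case/andP : s01. Qed.
Let s1 : s < 1. Proof. by case/andP : s01. Qed.
Let cK : ccont K. Proof. exact: ccont_scaled. Qed.
Let sC : s%:C != 0. Proof. by rewrite -normc_eq0 normcR gtr0_norm // gt_eqF. Qed.

(** Including the circle [|w| = s], where both branches agree, is what gives continuity across
    it. *)
Lemma glued_inside w : normc w <= s -> glued w = poisson_ext K (s%:C^-1 * w).
Proof.
move=> ws; rewrite /glued /poisson_ext normc_divs // ltr_pdivrMr // mul1r.
by case: ifP => // _; rewrite /K mulVKf.
Qed.

Lemma glued_ge w : disc w -> normc (f w) `^ p <= glued w.
Proof.
by move=> w1; rewrite /glued; case: ifP => // ws; exact: powR_le_scaled_poisson.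
Qed.

Lemma glued_continuous : {within (@disc R : set R[i]^o), continuous (glued : R[i]^o -> R)}.
Proof.
have wK : {within @circle R, continuous (K : R[i]^o -> R)}.
  apply: (@within_normc_powR _ _ (fun z => f (s%:C * z))) => // z z1.
  by apply: derivable_scale => //; rewrite z1 invf_gt1.
pose A : set R[i]^o := [set w | normc w <= s].
have cA : {within A, continuous (glued : R[i]^o -> R)}.
  have : {within A, continuous ((fun w => poisson_ext K (s%:C^-1 * w)) : R[i]^o -> R)}.
    apply: (within_compC (poisson_ext_continuous wK)) => z za.
      by rewrite /cdisc /mkset normc_divs // ler_pdivrMr // mul1r.
    by apply: cderivableMl; exact: derivable_id.
  move=> /within_normcP H; apply/within_normcP => z Az e e0.
  have [d d0 {}H] := H z Az e e0; exists d => // w Aw wz.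
  by rewrite !glued_inside //; exact: H.
have /within_normcP cB := within_normc_powR p0 af.
move/within_normcP : cA => cA.
apply/within_normcP => z z1 e e0.
have gO w : s <= normc w -> glued w = normc (f w) `^ p.
  by rewrite /glued leNgt => /negbTE ->.
have [zs|zs|zs] := ltgtP (normc z) s.
- have [d d0 H] := cA z (ltW zs) e e0.
  exists (Num.min d (s - normc z)); first by rewrite lt_min d0 subr_gt0.
  move=> w _; rewrite lt_min => /andP[wd ws]; apply: H => //.
  by rewrite /A /mkset; have := lerB_normc w z; lra.
- have [d d0 H] := cB z z1 e e0.
  exists (Num.min d (normc z - s)); first by rewrite lt_min d0 subr_gt0.
  move=> w w1; rewrite lt_min => /andP[wd ws].
  rewrite !gO ?(ltW zs) //; first exact: H.
  by have := lerB_normc z w; rewrite normc_distC; lra.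
- have zA : A z by rewrite /A /mkset zs.
  have [d d0 H] := cA z zA e e0; have [d' d'0 H'] := cB z z1 e e0.
  exists (Num.min d d'); first by rewrite lt_min d0.
  move=> w w1; rewrite lt_min => /andP[wd ws].
  have [sw|sw] := leP s (normc w); last by apply: H => //; exact: ltW.
  by rewrite !gO ?zs //; exact: H'.
Qed.

(** Inside the circle of radius [s] the Poisson integral is at most the maximum of [|f|^p] on that
    circle; outside the difference is zero. *)
Lemma glued_bounded : exists2 M, 0 <= M &
  forall w, disc w -> 0 <= glued w - normc (f w) `^ p <= M.
Proof.
have wK : {within @circle R, continuous (K : R[i]^o -> R)}.
  apply: (@within_normc_powR _ _ (fun z => f (s%:C * z))) => // z z1.
  by apply: derivable_scale => //; rewrite z1 invf_gt1.
have [M M0 KM] := circle_bounded wK; exists M => // w w1.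
rewrite subr_ge0 glued_ge //= /glued; case: ifP => ws; last by rewrite subrr.
rewrite lerBlDr; apply: (@le_trans _ _ M); last by rewrite lerDl powR_ge0.
rewrite -(poisson_cst (disc_div s0 ws) M); apply: le_poisson => //.
- exact: disc_div.
- exact: ccont_cst.
- by move=> z /KM; exact/le_trans/ler_norm.
Qed.

Section selfmap.
Variable phi : R[i] -> R[i].
Hypothesis aphi : analytic_on_disc phi.
Hypothesis dphi : forall z, disc z -> disc (phi z).

Let scale_disc r z : 0 <= r < 1 -> cdisc z -> disc (r%:C * z).
Proof.
move=> /andP[r0 r1] z1; rewrite /disc /= normcM normcR ger0_norm //.
by apply: le_lt_trans r1; rewrite -[leRHS]mulr1 ler_wpM2l.
Qed.

Let dphir r z : 0 <= r < 1 -> cdisc z ->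
  derivable ((fun z => phi (r%:C * z)) : R[i]^o -> R[i]^o) z 1.
Proof.
move=> r01 z1; apply: (@derivable_comp1 _ phi); last exact/aphi/scale_disc.
by apply: cderivableMl; exact: derivable_id.
Qed.

Lemma glued_compose_continuous r : 0 <= r < 1 ->
  {within @cdisc R, continuous ((fun z => glued (phi (r%:C * z))) : R[i]^o -> R)}.
Proof.
move=> r01; apply: (within_compC glued_continuous (F := fun z => phi (r%:C * z))).
  by move=> z z1; exact/dphi/scale_disc.
by move=> z z1; exact: dphir.
Qed.

(** If [phi] sends the point strictly inside radius [s], the composite is locally the real part of a
    holomorphic function. Otherwise its value there is [|f o phi|^p], which is at most its own
    circle means, and [glued] dominates it on those circles. *)
Lemma glued_submean r z : 0 <= r < 1 -> disc z ->
  submean (fun z => glued (phi (r%:C * z))) z.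
Proof.
move=> r01 z1; have z0 : 0 < 1 - normc z by rewrite subr_gt0.
have [zs|zs] := ltP (normc (phi (r%:C * z))) s.
  pose G u := schwarz K (s%:C^-1 * phi (r%:C * u)).
  have dr u : cdisc u -> derivable ((fun z => phi (r%:C * z)) : R[i]^o -> R[i]^o) u 1.
    exact: dphir.
  have e0 : 0 < s - normc (phi (r%:C * z)) by rewrite subr_gt0.
  have /within_normcP/(_ z (disc_cdisc z1) _ e0)[d d0 H] :=
    within_derivable (@ler_dist_normc R) dr.
  pose d' := Num.min d (1 - normc z).
  have d'0 : 0 < d' by rewrite lt_min d0.
  have inside u : normc (u - z) < d' -> disc u /\ normc (phi (r%:C * u)) < s.
    rewrite lt_min => /andP[ud uz]; have u1 := disc_near uz; split => //.
    by have := H u (disc_cdisc u1) ud; rewrite ltr_norml; lra.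
  have dG u : normc (u - z) < d' -> derivable (G : R[i]^o -> R[i]^o) u 1.
    move=> /inside[u1 us]; apply: (@derivable_comp1 _ (schwarz K)); last first.
      by apply: derivable_schwarz => //; exact: disc_div.
    by apply: cderivableMl; apply: dr; exact: disc_cdisc.
  have GE u : normc (u - z) < d' -> glued (phi (r%:C * u)) = Re (G u).
    by move=> /inside[_ us]; rewrite /glued us.
  exists d' => // t /andP[t0 td]; have t0d : 0 <= t < d' by rewrite ltW.
  rewrite GE ?subrr ?normc0 // -(mean_value_local d'0 dG t0d).
  rewrite le_eqVlt; apply/orP; left; apply/eqP; apply: eq_rmean => u u1.
  by rewrite GE // addrC addKr normcM u1 mulr1 normcR gtr0_norm.
exists (1 - normc z) => // t /andP[t0 tz].
have t0z : 0 <= t < 1 - normc z by rewrite ltW.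
rewrite {1}/glued ltNge zs /=.
pose F u := f (phi (r%:C * (z + t%:C * u))).
have dlt : 1 < (1 - normc z) / t by rewrite ltr_pdivlMr // mul1r.
have inD u : normc u < (1 - normc z) / t -> disc (z + t%:C * u).
  rewrite ltr_pdivlMr // => ut; rewrite /disc /=; apply: le_lt_trans (le_normcD _ _) _.
  by rewrite normcM normcR gtr0_norm // mulrC; lra.
have dF u : normc u < (1 - normc z) / t -> derivable (F : R[i]^o -> R[i]^o) u 1.
  move=> /inD u1; have u1' := disc_cdisc u1.
  apply: (@derivable_comp1 _ f); last exact/af/dphi/scale_disc.
  apply: (@derivable_comp1 _ (fun y => phi (r%:C * y))); last exact: dphir.
  exact: cderivable_affine.
have := normc_powR_le_poisson dlt p0 dF (@disc0 R).
rewrite poisson0 {1}/F mulr0 addr0 => /le_trans; apply.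
have onC u : circle u -> normc u < (1 - normc z) / t by move=> ->.
apply: le_rmean.
- apply: within_circle_ccont; apply: within_normc_powR => // u u1.
  by apply: dF; exact: onC.
- apply: (ccont_within (v := fun z => glued (phi (r%:C * z))) (glued_compose_continuous r01)).
  by move=> u u1; apply/disc_cdisc/inD/onC.
- move=> u u1; apply: glued_ge; apply/dphi/scale_disc => //.
  by apply/disc_cdisc/inD/onC.
Qed.

End selfmap.

Lemma inner_mean_lower phi (N : R) : inner_function phi ->
  (forall r, 0 <= r < 1 -> pmean p (fun z => f (phi z)) r <= N) ->
  normc (phi 0) < s ->
  (1 - normc (phi 0) / s) / 2 * pmean p f s <= N.
Proof.
move=> [aphi dphi bphi] HN phi0s.
rewrite -normc_divs //.
apply: le_trans (mean_le_poisson (disc_div s0 phi0s) cK _) _.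
  by move=> z _; exact: powR_ge0.
have afp := analytic_compose aphi dphi af.
pose e r z := glued (phi (r%:C * z)) - normc (f (phi (r%:C * z))) `^ p.
have [M M0 gM] := glued_bounded.
have ce r : 0 <= r < 1 -> ccont (e r).
  move=> r01; apply: ccontB; last exact: (ccont_pmean p0 afp r01).
  apply: within_circle_ccont; apply: within_subset (@circle_cdisc R) _.
  exact: glued_compose_continuous.
(* The sub-mean inequality at the centre for the circle of radius [r], with the majorant split into
   [|f o phi|^p], of mean at most [N], and the error [e r]. *)
have step r : 0 <= r < 1 -> poisson K (s%:C^-1 * phi 0) <= N + rmean (e r).
  move=> r01; have cg := glued_compose_continuous aphi dphi r01.
  have := submean_mean cg (fun z => glued_submean aphi dphi r01).
  rewrite mulr0 {1}/glued phi0s => /le_trans; apply.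
  rewrite (@eq_rmean _ _ (fun z => normc (f (phi (r%:C * z))) `^ p + e r z)).
    rewrite rmeanD ?lerD2r; [exact: HN|exact: (ccont_pmean p0 afp r01)|exact: ce].
  by move=> z _; rewrite /e subrKC.
(* Dominated convergence is stated for sequences; all these radii are below 1, as the one-sided
   radial limit requires. *)
pose rn (n : nat) : R := 1 - n.+1%:R^-1.
have rn01 n : 0 <= rn n < 1.
  rewrite /rn subr_ge0 invf_le1 ?ltr0n // ler1n /= ltrBlDr ltrDl invr_gt0 ltr0n //.
have rlim : rn @ \oo --> (1 : R).
  rewrite -[X in _ --> X]subr0; apply: cvgB; first exact: cvg_cst.
  exact: cvg_harmonic.
pose D : set R := [set` `[0, 2 * pi]].
have DC : [sequence (\int[mu]_(x in D) (e (rn n) (circle_pt x))%:E)%E]_n @ \oo -->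
    (\int[mu]_(x in D) (cst 0%E x))%E.
  have [||||||_ _ //] := @dominated_convergence _ _ _ mu D _
    (fun n x => (e (rn n) (circle_pt x))%:E) (cst 0%E) (cst M%:E).
  - exact: measurable_itv.
  - move=> n; apply/measurable_EFinP.
    exact: (measurable_funS measurableT (@subsetT _ D) (continuous_measurable_fun (ce _ (rn01 n)))).
  - exact: measurable_cst.
  - case: bphi => A [mA A0 sA]; exists A; split=> // t; apply: contra_notP => At Dt.
    have [w wlim w1] : exists2 w : R[i]^o,
        (phi (r%:C * circle_pt t) : R[i]^o) @[r --> (1 : R)^'-] --> w & normc w = 1.
      by apply: contrapT => nw; apply/At/sA => /= /(_ Dt).
    (* The error is eventually equal to zero: the radial limit has modulus 1, so [|phi|] ends up
       above [s], where [glued] is [|f|^p]. *)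
    apply: cvg_near_cst.
    have s1' : 0 < 1 - s by rewrite subr_gt0.
    have nw : nbhs (w : R[i]^o) (fun u : R[i]^o => s <= normc u).
      apply/nbhs_normcP; exists (1 - s) => // u uw.
      by have := lerB_normc w u; rewrite normc_distC w1; lra.
    have H : nbhs (1 : R)^'- (fun r => s <= normc (phi (r%:C * circle_pt t))) := wlim _ nw.
    have {}H : nbhs (1 : R) (fun r => r < 1 -> s <= normc (phi (r%:C * circle_pt t))) := H.
    have {}H : \forall n \near \oo, rn n < 1 -> s <= normc (phi ((rn n)%:C * circle_pt t))
      := rlim _ H.
    near=> n; have Hn : rn n < 1 -> s <= normc (phi ((rn n)%:C * circle_pt t)) by near: n.
    have /andP[_ /Hn sn] := rn01 n.
    by rewrite /e /glued ltNge sn /= subrr.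
  - apply: integrable_itv; apply: within_itvP => x _; exact: cst_continuous.
  - apply: aeW => x n _ /=; rewrite lee_fin.
    have /andP[h1 h2] : 0 <= e (rn n) (circle_pt x) <= M.
      by apply/gM/dphi/disc_scale => //; exact: normc_circle.
    by rewrite ger0_norm.
rewrite integral0 in DC.
have {}DC : (fun n => \int[mu]_(x in D) e (rn n) (circle_pt x)) @ \oo --> (0 : R).
  exact: (fine_cvg DC).
apply/ler_addgt0Pr => d d0.
have d1 : 0 < 2 * pi * d by rewrite mulr_gt0 // twopi_gt0.
have [n Hn] : exists n, `|0 - \int[mu]_(x in D) e (rn n) (circle_pt x)| < 2 * pi * d.
  move/cvgrPdist_lt : DC => /(_ _ d1) DC.
  by have [n _ /(_ n (leqnn n)) H] := DC; exists n.
apply: le_trans (step _ (rn01 n)) _; rewrite lerD2l /rmean.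
rewrite mulrC ler_pdivrMr ?twopi_gt0 // [d * _]mulrC ltW //.
by apply: le_lt_trans Hn; rewrite sub0r normrN ler_norm.
Unshelve. all: by end_near. Qed.

End glue.
End lower_bound.

(** * Completeness and closed range *)

Section completeness.
Variable R : realType.
Local Notation Re := (@complex.Re R).
Local Notation Im := (@complex.Im R).
Implicit Types (f : R[i] -> R[i]) (z : R[i]).

Lemma cauchy_limit (u : nat -> R) :
  (forall e, 0 < e -> exists N, forall n m, (N <= n)%N -> (N <= m)%N -> `|u n - u m| <= e) ->
  exists l, forall e, 0 < e -> exists N, forall n, (N <= n)%N -> `|u n - l| <= e.
Proof.
move=> H; have cu : cvg (u @ \oo).
  apply/cauchy_cvgP/cauchy_exP => e e0.
  have e2 : 0 < e / 2 by rewrite divr_gt0.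
  have [N HN] := H _ e2; exists (u N); exists N => // n /= Nn.
  by rewrite /ball /=; apply: le_lt_trans (HN N n (leqnn N) Nn) _; lra.
exists (lim (u @ \oo)) => e e0.
move/cvgrPdist_le : cu => /(_ e e0)[N _ HN]; exists N => n Nn.
by rewrite distrC; exact: HN.
Qed.

Lemma cauchy_climit (u : nat -> R[i]) :
  (forall e : R, 0 < e -> exists N, forall n m, (N <= n)%N -> (N <= m)%N ->
    normc (u n - u m) <= e) ->
  exists l, forall e : R, 0 < e -> exists N, forall n, (N <= n)%N -> normc (u n - l) <= e.
Proof.
move=> H.
have [|a Ha] := @cauchy_limit (fun n => Re (u n)).
  move=> e e0; have [N HN] := H e e0; exists N => n m Nn Nm.
  exact: le_trans (lip_Re _ _) (HN n m Nn Nm).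
have [|b Hb] := @cauchy_limit (fun n => Im (u n)).
  move=> e e0; have [N HN] := H e e0; exists N => n m Nn Nm.
  exact: le_trans (lip_Im _ _) (HN n m Nn Nm).
exists (a +i* b) => e e0; have e2 : 0 < e / 2 by rewrite divr_gt0.
have [N1 H1] := Ha _ e2; have [N2 H2] := Hb _ e2.
exists (maxn N1 N2) => n; rewrite geq_max => /andP[n1 n2].
apply: le_trans (normc_le_ReIm _) _; rewrite (splitr e) cReD cImD cReN cImN /=.
by rewrite lerD ?H1 ?H2.
Qed.

(** The pointwise limit is set to 0 off the disc, so that it can represent an element of
    [hardy p]. *)
Lemma uniform_cauchy_limit (f_ : nat -> R[i] -> R[i]) :
  (forall r e : R, r < 1 -> 0 < e -> exists N, forall n m, (N <= n)%N -> (N <= m)%N ->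
    forall z, normc z <= r -> normc (f_ n z - f_ m z) <= e) ->
  exists2 f, forall z, ~ disc z -> f z = 0 &
    forall r e : R, r < 1 -> 0 < e -> exists N, forall n, (N <= n)%N ->
      forall z, normc z <= r -> normc (f_ n z - f z) <= e.
Proof.
move=> H.
have /choice[f Hf] : forall z, exists l, (~ disc z -> l = 0) /\ (disc z ->
    forall e : R, 0 < e -> exists N, forall n, (N <= n)%N -> normc (f_ n z - l) <= e).
  move=> z; have [z1|z1] := pselect (disc z); last by exists 0.
  have [|l Hl] := @cauchy_climit (f_ ^~ z); last by exists l.
  move=> e e0; have [N HN] := H _ e z1 e0; exists N => n m Nn Nm; exact: HN.
exists f => [z z1|r e r1 e0]; first by have [H0 _] := Hf z; exact: H0.
have e2 : 0 < e / 2 by rewrite divr_gt0.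
have [N HN] := H r _ r1 e2; exists N => n Nn z zr.
have [_ /(_ (le_lt_trans zr r1) _ e2)[M HM]] := Hf z.
have -> : f_ n z - f z = (f_ n z - f_ (maxn N M) z) + (f_ (maxn N M) z - f z) by ring.
apply: le_trans (le_normcD _ _) _; rewrite (splitr e) lerD //.
  by apply: HN => //; exact: leq_maxl.
by apply: HM; exact: leq_maxr.
Qed.

End completeness.

(** * The composition operator and its range *)

Section composition.
Variables (R : realType) (p : {posnum R}).
Implicit Types (f g : R[i] -> R[i]) (w z : R[i]) (phi : R[i] -> R[i]).
Let p0 : 0 < p%:num. Proof. by []. Qed.

(** The estimate on one circle needs a radius above [|phi 0|] and degenerates near it. Radii from
    [s] on are treated directly; smaller ones by the pointwise bound from a larger circle. Only a
    bound [N] on the means of [f o phi] is assumed, so differences of elements of H^p are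
    covered. *)
Lemma inner_lower_bound phi : inner_function phi -> exists C : R, 0 <= C /\
  forall f (N : R), analytic_on_disc f ->
  (forall r, 0 <= r < 1 -> pmean p%:num (fun z => f (phi z)) r <= N) ->
  forall r, 0 <= r < 1 -> pmean p%:num f r <= C * N.
Proof.
move=> iphi; have [aphi dphi _] := iphi.
pose a := normc (phi 0); have a0 : 0 <= a := normc_ge0 _.
have a1 : a < 1 by apply: dphi; exact: disc0.
(* Beyond [s] the single-circle constant is at most [C]. The gap between [s] and [s'] makes the
   pointwise factor at most [C'] on all radii below [s]. *)
pose s := (1 + a) / 2; pose s' := (1 + s) / 2.
have a_s : a < s by rewrite /s; lra.
have s1 : s < 1 by rewrite /s; lra.
have s_s' : s < s' by rewrite /s'; lra.
have s'1 : s' < 1 by rewrite /s'; lra.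
have s0 : 0 < s by lra.
have as1 : 0 < 1 - a / s by rewrite subr_gt0 ltr_pdivrMr // mul1r.
have ss1 : 0 < 1 - s / s' by rewrite subr_gt0 ltr_pdivrMr ?mul1r //; lra.
pose C := 2 / (1 - a / s); have C0 : 0 < C by rewrite divr_gt0.
pose C' := 2 / (1 - s / s'); have C'0 : 0 < C' by rewrite divr_gt0.
have C0' := ltW C0; have C'0' := ltW C'0.
exists (C + C' * C); split; first by apply: addr_ge0 => //; exact: mulr_ge0.
move=> f N af HN.
have N0 : 0 <= N.
  have r00 : 0 <= (0 : R) < 1 by rewrite lexx ltr01.
  exact: le_trans (pmean_ge0 _ _ _) (HN 0 r00).
have large t : s <= t -> t < 1 -> pmean p%:num f t <= C * N.
  move=> st t1; have t0 : 0 < t by lra.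
  have at1 : 0 < 1 - a / t by rewrite subr_gt0 ltr_pdivrMr // mul1r; lra.
  have t01 : 0 < t < 1 by rewrite t0.
  have at_ : normc (phi 0) < t by rewrite -/a; lra.
  have := inner_mean_lower p0 af t01 iphi HN at_; rewrite -/a => H.
  have K : (1 - a / t) / 2 >= C^-1.
    rewrite /C invf_div ler_pM2r // lerD2l lerN2 ler_wpM2l // lef_pV2 ?posrE //.
  rewrite mulrC -ler_pdivrMr // mulrC; apply: le_trans H.
  by rewrite ler_wpM2r // pmean_ge0.
move=> r /andP[r0 r1]; have [sr|rs] := leP s r.
  apply: le_trans (large r sr r1) _; rewrite mulrDl lerDl.
  by apply: mulr_ge0 => //; exact: mulr_ge0.
have r01 : 0 <= r < 1 by rewrite r0.
apply: (@le_trans _ _ (C' * C * N)); last by rewrite mulrDl lerDr; exact: mulr_ge0.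
rewrite -[leRHS]rmean_cst; apply: le_rmean.
- exact: ccont_pmean.
- exact: ccont_cst.
move=> z z1; have zr : normc (r%:C * z) = r by rewrite normcM z1 mulr1 normcR ger0_norm.
have s'01 : 0 < s' < 1 by rewrite s'1 andbT; lra.
have rs' : normc (r%:C * z) < s' by rewrite zr; lra.
apply: le_trans (pointwise_bound p0 af s'01 rs') _; rewrite zr -[leRHS]mulrA.
have rs1 : 0 < 1 - r / s' by rewrite subr_gt0 ltr_pdivrMr ?mul1r //; lra.
apply: ler_pM; [by rewrite divr_ge0 // ltW|exact: pmean_ge0| |exact: large (ltW s_s') s'1].
rewrite /C' ler_pM2l // lef_pV2 ?posrE // lerD2l lerN2 ler_pM2r ?invr_gt0; lra.
Qed.

(** Off the disc [phi] is arbitrary, so the zero required by [hardy_supp] is imposed by hand. *)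
Definition compose_ext phi f z := if normc z < 1 then f (phi z) else 0.

Lemma compose_extE phi f z : disc z -> compose_ext phi f z = f (phi z).
Proof. by rewrite /compose_ext => z1; rewrite (z1 : is_true (_ < 1)). Qed.

Lemma compose_ext_analytic phi f : inner_function phi -> analytic_on_disc f ->
  analytic_on_disc (compose_ext phi f).
Proof.
move=> [aphi dphi _] af z z1; have z0 : 0 < 1 - normc z by rewrite subr_gt0.
apply: derivable_eq_near z0 _ (analytic_compose aphi dphi af z1) => w wz.
by rewrite compose_extE //; exact: (disc_near wz).
Qed.

Lemma compose_ext_supp phi f z : ~ disc z -> compose_ext phi f z = 0.
Proof. by rewrite /compose_ext /disc /= => /negP/negbTE ->. Qed.

Lemma eq_hardy_normp f g : (forall z, disc z -> f z = g z) ->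
  hardy_normp p%:num f = hardy_normp p%:num g.
Proof.
move=> fg; congr ereal_sup; apply: eq_imagel => r; rewrite /= in_itv /= => r01.
rewrite /circle_mean; congr (_ * _)%E; apply: eq_integral => t _.
by rewrite fg //; apply: disc_scale => //; exact: normc_circle.
Qed.

Lemma compose_ext_fin phi f : inner_function phi -> analytic_on_disc f ->
  (hardy_normp p%:num f < +oo)%E -> (hardy_normp p%:num (compose_ext phi f) < +oo)%E.
Proof.
move=> [aphi dphi _] af fin.
rewrite (@eq_hardy_normp _ (fun z => f (phi z))); last by move=> z; exact: compose_extE.
exact: compose_hardy_fin.
Qed.

Lemma analytic_hardy (f : hardy p) : analytic_on_disc f. Proof. exact: hardy_analytic. Qed.
Arguments analytic_hardy : clear implicits.

Definition composition phi (iphi : inner_function phi) (f : hardy p) : hardy p :=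
  Hardy (compose_ext_analytic iphi (analytic_hardy f)) (@compose_ext_supp phi _)
    (compose_ext_fin iphi (analytic_hardy f) (hardy_fin f)).

Lemma hardy_eq (f g : hardy p) : (forall z, disc z -> f z = g z) -> f = g.
Proof.
move=> fg; have E : hardy_fun f = hardy_fun g.
  apply/funext => z; have [z1|z1] := pselect (disc z); first exact: fg.
  by rewrite !hardy_supp.
case: f g E {fg} => f a b c [g a' b' c'] /= E; case: g / E a' b' c' => a' b' c'.
by congr Hardy; exact: Prop_irrelevance.
Qed.

Lemma powR_small (c e : R) : 0 <= c -> 0 < e -> exists2 d, 0 < d & c * d <= e `^ p%:num.
Proof.
move=> c0 e0; have c1 : 0 < c + 1 by rewrite ltr_wpDl.
have E0 : 0 < e `^ p%:num by rewrite powR_gt0.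
exists (e `^ p%:num / (c + 1)); first by rewrite divr_gt0.
by rewrite mulrCA ler_piMr ?(ltW E0) // ler_pdivrMr // mul1r lerDl.
Qed.

Lemma composition_range_closed phi (iphi : inner_function phi) :
  closed (range (composition iphi)).
Proof.
have [aphi dphi _] := iphi.
move=> g clg.
have c2 : 0 < 2 `^ p%:num :> R by rewrite powR_gt0.
pose q := p%:num.
have ag := analytic_hardy g.
have approx n : exists f : hardy p,
    (hardy_normp q (fun z => (g z - composition iphi f z)%R) < (n.+1%:R^-1)%:E)%E.
  have n0 : 0 < n.+1%:R^-1 :> R by rewrite invr_gt0 ltr0n.
  have ent : entourage (hardy_ball (p := p) n.+1%:R^-1).
    by exists n.+1%:R^-1.
  have [_ [[f _ <-] /xsectionP H]] := clg _ (nbhs_entourage g ent).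
  by exists f.
have {approx} [f_ Hf] := choice approx.
have af n := analytic_hardy (f_ n).
have aC n := analytic_hardy (composition iphi (f_ n)).
have CE n z : disc z -> composition iphi (f_ n) z = f_ n (phi z).
  by move=> z1; rewrite /= compose_extE.
have diffC n m r : 0 <= r < 1 -> pmean q (fun z => f_ n (phi z) - f_ m (phi z)) r <=
    2 `^ q * (n.+1%:R^-1 + m.+1%:R^-1).
  move=> r01.
  have aD := analyticB (af n) (af m).
  rewrite -lee_fin; apply: (le_trans (pmean_le_hardy p0 (analytic_compose aphi dphi aD) r01)).
  rewrite (@eq_hardy_normp _ (fun z => composition iphi (f_ n) z - composition iphi (f_ m) z));
    last by move=> z z1; rewrite !CE.
  apply: le_trans (hardy_normpD p0 (analyticB (aC n) ag) (analyticB ag (aC m)) _) _.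
    by move=> z; rewrite addrA subrK.
  rewrite EFinM; apply: lee_wpmul2l; first by rewrite lee_fin ltW.
  rewrite EFinD; apply: leeD; last by apply: ltW; exact: Hf.
  rewrite (@hardy_normpN _ _ (fun z => g z - composition iphi (f_ n) z)).
    by apply: ltW; exact: Hf.
  by move=> z; rewrite opprB.
have [C [C0 HC]] := inner_lower_bound iphi.
have diff n m r : 0 <= r < 1 -> pmean q (fun z => f_ n z - f_ m z) r <=
    C * (2 `^ q * (n.+1%:R^-1 + m.+1%:R^-1)).
  move=> r01; have aD := analyticB (af n) (af m).
  exact: (HC (fun z => f_ n z - f_ m z) _ aD (diffC n m) r r01).
have inv_small d : 0 < d -> exists N, forall n, (N <= n)%N -> n.+1%:R^-1 <= d :> R.
  move=> d0; have [N _ H] := near_infty_natSinv_lt (PosNum d0).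
  by exists N => n Nn; apply/ltW; exact: H.
have unif (r e : R) : r < 1 -> 0 < e -> exists N, forall n m, (N <= n)%N -> (N <= m)%N ->
    forall z, normc z <= r -> normc (f_ n z - f_ m z) <= e.
  (* The bound [r] may be negative, so it is first replaced by a nonnegative radius. *)
  move=> r1 e0; pose r' := Num.max r 0.
  have r'1 : r' < 1 by rewrite gt_max r1 ltr01.
  have r'0 : 0 <= r' by rewrite le_max lexx orbT.
  pose s := (1 + r') / 2.
  have s01 : 0 < s < 1 by rewrite /s; lra.
  have rs : r' < s by rewrite /s; lra.
  have s0 : 0 < s by case/andP : s01.
  (* The pointwise factor times the bound [diff]; the last 2 accounts for the two reciprocals, each
     at most [d]. *)
  pose c := 2 / (1 - r' / s) * (C * (2 `^ q * 2)).
  have rs1 : 0 < 1 - r' / s by rewrite subr_gt0 ltr_pdivrMr // mul1r.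
  have c0 : 0 <= c.
    by rewrite mulr_ge0 ?divr_ge0 ?(ltW rs1) // mulr_ge0 // mulr_ge0 // ltW.
  have [d d0 cd] := powR_small c0 e0.
  have [N HN] := inv_small d d0; exists N => n m Nn Nm z zr.
  have zr' : normc z <= r' by rewrite le_max zr.
  apply: (powR_le_reg p0 (ltW e0)); apply: le_trans cd.
  have zs : normc z < s := le_lt_trans zr' rs.
  apply: le_trans (pointwise_bound p0 (analyticB (af n) (af m)) s01 zs) _.
  rewrite /c -[leRHS]mulrA; apply: ler_pM.
  - by rewrite divr_ge0 // subr_ge0 ler_pdivrMr // mul1r ltW.
  - exact: pmean_ge0.
  - rewrite ler_pM2l // lef_pV2 ?posrE ?subr_gt0 ?ltr_pdivrMr ?mul1r //.
    by rewrite lerD2l lerN2 ler_pM2r ?invr_gt0.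
  have s01' : 0 <= s < 1 by case/andP : s01 => _ ->; rewrite ltW.
  apply: le_trans (diff n m s s01') _.
  rewrite -!mulrA ler_wpM2l // ler_pM2l //.
  by rewrite mulr_natl mulr2n lerD ?HN.
have [f f0 Hlim] := uniform_cauchy_limit unif.
have aF : analytic_on_disc f.
  apply: (analytic_limit af) => r e r1 e0; have [N HN] := Hlim r e r1 e0.
  by exists N => z; exact: HN.
have gfin : hardy_normp q g \is a fin_num.
  rewrite ge0_fin_numE; first exact: hardy_fin.
  have r00 : 0 <= (0 : R) < 1 by rewrite lexx ltr01.
  by apply: le_trans (pmean_le_hardy p0 ag r00); rewrite lee_fin pmean_ge0.
(* Every composition is within 1 of [g], so the lower bound gives a bound on the means of [f_ n]
   free of [n] and [r]. *)
pose B := C * (2 `^ q * (1 + fine (hardy_normp q g))).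
have fB n r : 0 <= r < 1 -> pmean q (f_ n) r <= B.
  move=> r01; apply: (HC (f_ n) _ (af n) _ r r01) => r' r'01; rewrite -lee_fin.
  apply: (le_trans (pmean_le_hardy p0 (analytic_compose aphi dphi (af n)) r'01)).
  rewrite (@eq_hardy_normp _ (composition iphi (f_ n))); last by move=> z z1; rewrite CE.
  apply: le_trans (hardy_normpD p0 (analyticB (aC n) ag) ag _) _.
    by move=> z; rewrite subrK.
  rewrite EFinM; apply: lee_wpmul2l; first by rewrite lee_fin ltW.
  rewrite EFinD fineK //; apply: leeD => //.
  rewrite (@hardy_normpN _ _ (fun z => g z - composition iphi (f_ n) z)).
    apply: le_trans (ltW (Hf n)) _; rewrite lee_fin invf_le1 ?ltr0n // ler1n //.
  by move=> z; rewrite opprB.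
have fin : (hardy_normp q f < +oo)%E.
  apply: (@le_lt_trans _ _ (2 `^ q * (1 + B))%:E); last exact: ltey.
  apply: (hardy_le p0 aF) => r r01.
  have [N HN] := Hlim r 1 (proj2 (andP r01)) ltr01.
  rewrite -lee_fin -circle_meanE //.
  apply: le_trans (circle_meanD p0 (analyticB aF (af N)) (af N) _ _) _.
  - by rewrite in_itv.
  - by move=> z; rewrite subrK.
  have aD := analyticB aF (af N).
  rewrite (circle_meanE p0 aD r01) (circle_meanE p0 (af N) r01).
  rewrite -EFinD -EFinM lee_fin ler_pM2l //; apply: lerD; last exact: fB.
  rewrite -[leRHS]rmean_cst; apply: le_rmean; [|exact: ccont_cst|].
    exact: (ccont_pmean p0 aD r01).
  move=> z z1; apply: (@le_trans _ _ (1 `^ q)); last by rewrite powR1.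
  apply: ge0_ler_powR; rewrite ?nnegrE ?normc_ge0 //.
  rewrite normc_distC; apply: HN => //.
  by rewrite normcM z1 mulr1 normcR ger0_norm //; case/andP : r01.
(* At a fixed [z], [f_ n (phi z)] tends to [f (phi z)] by locally uniform convergence, and to [g z]
   by the pointwise bound applied to [g] minus the composition. *)
exists (Hardy aF f0 fin) => //; apply: hardy_eq => z z1 /=; rewrite compose_extE //.
apply/eqP; rewrite -subr_eq0 -normc_eq0 eq_le normc_ge0 andbT.
apply/ler_addgt0Pr => e e0; rewrite add0r.
have e2 : 0 < e / 2 by rewrite divr_gt0.
have zlt : normc z < 1 by []; have zge := normc_ge0 z.
pose s := (1 + normc z) / 2.
have s01 : 0 < s < 1 by rewrite /s; lra.
have s01' : 0 <= s < 1 by case/andP : s01 => /ltW -> ->.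
have zs : normc z < s by rewrite /s; lra.
have s0 : 0 < s by case/andP : s01.
pose c := 2 / (1 - normc z / s).
have c0 : 0 <= c by rewrite divr_ge0 // subr_ge0 ler_pdivrMr // mul1r ltW.
have [d d0 cd] := powR_small c0 e2.
have [N1 HN1] := inv_small d d0.
have [N2 HN2] := Hlim _ _ (dphi z z1) e2.
pose n := maxn N1 N2.
have -> : f (phi z) - g z = - (f_ n (phi z) - f (phi z)) - (g z - composition iphi (f_ n) z).
  by rewrite CE //; ring.
apply: le_trans (le_normcD _ _) _; rewrite !normcN (splitr e) lerD //.
  by apply: HN2 => //; exact: leq_maxr.
apply: (powR_le_reg p0 (ltW e2)); apply: le_trans cd.
apply: le_trans (pointwise_bound p0 (analyticB ag (aC n)) s01 zs) _.
rewrite ler_wpM2l //; apply: le_trans (HN1 n (leq_maxl _ _)).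
rewrite -lee_fin; apply: le_trans (ltW (Hf n)).
exact: (pmean_le_hardy p0 (analyticB ag (aC n)) s01').
Qed.

End composition.

(** Values on the disc determine [C_phi], since elements of [hardy p] vanish elsewhere; its
    existence as a map into [hardy p] includes Littlewood's theorem. *)
Theorem proposition3p2 (R : realType) (p : {posnum R}) (phi : R[i] -> R[i])
    (hphi : inner_function phi) :
  exists C_phi : hardy p -> hardy p,
    (forall (f : hardy p) (z : R[i]), disc z -> C_phi f z = f (phi z)) /\
    closed (range C_phi).
Proof.
exists (composition hphi); split; last exact: composition_range_closed.
by move=> f z z1; rewrite /= compose_extE.
Qed.
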